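(* For every $n\ge1$ and every finite set $A$, the inclusion $\mathscr G_n(A)\hookrightarrow\mathscr G_n^{\mathrm{ext}}(A)$ induces a weak homotopy equivalence of classifying spaces $|\mathscr G_n(A)|\to|\mathscr G_n^{\mathrm{ext}}(A)|$; hence the inclusion $|\mathscr G_n|\hookrightarrow|\mathscr G_n^{\mathrm{ext}}|$ is an equivalence of topological operads.
   Context: For a finite set $A$ and $n\ge1$, a weighted complete directed graph on $A$ assigns to each two-element subset $\{a,b\}\subseteq A$ exactly one directed edge, $a\to b$ or $b\to a$, together with a weight in $\{1,\dots,n\}$; write $a\xrightarrow{w}b$. Such graphs are ordered by: $g\le h$ iff for all $a\neq b$, whenever $a\xrightarrow{v}b$ in $g$, either $a\xrightarrow{w}b$ in $h$ with $v\le w$, or $b\xrightarrow{w}a$ in $h$ with $v<w$. $\mathscr G_n(A)$ is the subposet of acyclic such graphs (equivalently, the directions form a linear order on $A$); $\mathscr G_n^{\mathrm{ext}}(A)\supseteq\mathscr G_n(A)$ is the subposet of graphs containing no directed cycle all of whose edges have the same weight. Bijections act by relabelling vertices, and the operad composition $g\circ_a h$ (for $g$ on $A$, $h$ on $B$, $a\in A$) is the graph on $(A\setminus\{a\})\sqcup B$ whose edges among $A\setminus\{a\}$ are as in $g$, among $B$ are as in $h$, and whose edge between $a'\in A\setminus\{a\}$ and $b\in B$ has the direction and weight of the edge between $a'$ and $a$ in $g$ (with $a$ replaced by $b$). $|\cdot|$ denotes classifying spaces. *)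

(* Defs.v *)
From mathcomp Require Import all_boot all_order all_algebra.
From mathcomp Require Import all_classical all_reals all_analysis.

Set Implicit Arguments.
Unset Strict Implicit.
Unset Printing Implicit Defensive.

Import Order.TTheory GRing.Theory Num.Theory.
Import numFieldNormedType.Exports.
Local Open Scope classical_set_scope.
Local Open Scope ring_scope.

(* Weighted complete directed graphs on a finite set A with weights in      *)
(* {1,..,n}.  A graph is encoded by w : A * A -> {0,..,n}:                   *)
(*   w (a,b) = v > 0  means the edge a --v--> b,                             *)
(*   w (a,b) = 0      means there is no edge from a to b.                    *)

Definition graph (n : nat) (A : finType) := {ffun A * A -> 'I_n.+1}.

Definition wgt n (A : finType) (g : graph n A) (a b : A) : nat := g (a, b).

Definition wf_graph n (A : finType) (g : graph n A) : bool :=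
  [forall a : A, wgt g a a == 0%N] &&
  [forall a : A, forall b : A,
      (a != b) ==> ((0 < wgt g a b)%N != (0 < wgt g b a)%N)].

Definition graph_le n (A : finType) (g h : graph n A) : bool :=
  [forall a : A, forall b : A,
     ((a != b) && (0 < wgt g a b)%N) ==>
       (((0 < wgt h a b)%N && (wgt g a b <= wgt h a b)%N) ||
        ((0 < wgt h b a)%N && (wgt g a b < wgt h b a)%N))].

Definition edge n (A : finType) (g : graph n A) : rel A :=
  fun a b => (0 < wgt g a b)%N.
Definition edge_w n (A : finType) (g : graph n A) (k : nat) : rel A :=
  fun a b => (0 < k)%N && (wgt g a b == k).

Definition acyclic n (A : finType) (g : graph n A) : Prop :=
  forall s : seq A, s != [::] -> ~~ cycle (edge g) s.

Definition no_mono_cycle n (A : finType) (g : graph n A) : Prop :=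
  forall (k : nat) (s : seq A), s != [::] -> ~~ cycle (edge_w g k) s.

Definition Gn n (A : finType) : set (graph n A) :=
  [set g | wf_graph g /\ acyclic g].
Definition Gn_ext n (A : finType) : set (graph n A) :=
  [set g | wf_graph g /\ no_mono_cycle g].

(* Classifying space of a finite poset (S, le), S a subset of a finite type *)
(* P: the geometric realization of its nerve, realized as the order complex *)
(* inside P -> R (product topology): barycentric coordinates supported on a *)
(* chain of S.                                                              *)

Definition classifying_space (R : realType) (P : finType) (le : rel P)
    (S : set P) : set {ptws P -> R} :=
  [set t | (forall p, 0 <= t p) /\ (\sum_(p : P) t p = 1) /\
           (forall p, t p != 0 -> S p) /\
           (forall p q, t p != 0 -> t q != 0 -> le p q \/ le q p)].
Arguments classifying_space : clear implicits.

(* Homotopy groups, as homotopy classes of maps (I^k, dI^k) -> (X, x)       *)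
(* rel boundary, for subspaces X of a topological type T (k = 0 gives pi_0).*)

Definition cube (R : realType) (k : nat) : set {ptws 'I_k -> R} :=
  [set u | forall i, 0 <= u i <= 1].
Arguments cube : clear implicits.
Definition cube_bd (R : realType) (k : nat) : set {ptws 'I_k -> R} :=
  [set u | cube R k u /\ exists i, u i = 0 \/ u i = 1].
Arguments cube_bd : clear implicits.

Definition sphere_map (R : realType) (T : topologicalType) (X : set T) (x : T)
    (k : nat) (a : {ptws 'I_k -> R} -> T) : Prop :=
  {within cube R k, continuous a} /\ a @` cube R k `<=` X /\
  (forall u, cube_bd R k u -> a u = x).

Definition rel_homotopic (R : realType) (T : topologicalType) (X : set T)
    (x : T) (k : nat) (a b : {ptws 'I_k -> R} -> T) : Prop :=
  exists H : {ptws 'I_k -> R} * R -> T,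
    {within [set p | cube R k p.1 /\ 0 <= p.2 <= 1], continuous H} /\
    (forall u t, cube R k u -> 0 <= t <= 1 -> X (H (u, t))) /\
    (forall u, cube R k u -> H (u, 0) = a u /\ H (u, 1) = b u) /\
    (forall u t, cube_bd R k u -> 0 <= t <= 1 -> H (u, t) = x).

Definition weak_homotopy_equivalence (R : realType) (T U : topologicalType)
    (X : set T) (Y : set U) (f : T -> U) : Prop :=
  {within X, continuous f} /\ f @` X `<=` Y /\
  (* pi_0 surjective *)
  (forall y, Y y -> exists x, X x /\
       rel_homotopic Y y (fun _ : 'I_0 -> R => f x) (fun _ => y)) /\
  (* bijection on pi_k(X, x) -> pi_k(Y, f x) for all k >= 0 and all x *)
  (forall x, X x -> forall k : nat,
     (forall b : {ptws 'I_k -> R} -> U, sphere_map Y (f x) b ->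
        exists a, sphere_map X x a /\ rel_homotopic Y (f x) (f \o a) b) /\
     (forall a b : {ptws 'I_k -> R} -> T, sphere_map X x a -> sphere_map X x b ->
        rel_homotopic Y (f x) (f \o a) (f \o b) -> rel_homotopic X x a b)).

(* Main.v *)
Require Import Defs.
From mathcomp Require Import all_boot all_order all_algebra.
From mathcomp Require Import all_classical all_reals all_analysis.
From mathcomp Require Import zify ring lra.
Import numFieldNormedType.Exports.

(* Let M be the poset of graphs satisfying the ultrametric inequality
   w(a,c) <= max(w(a,b), w(b,c)): these index the Fox-Neuwirth cells of the
   configuration spaces of R^n, and they are acyclic, so M lies in Gn. By the
   argument of Quillen's Theorem A it suffices that M_{>= g} is contractible for
   every g in Gn_ext: the elements of Gn_ext outside Gn can then be removed one
   by one, each time by a strong deformation retraction, because the elements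
   above a removed one form a contractible link.

   For each weight k choose a linear order tau_k extending the edges of weight k
   of g, and let X_k be the set of h in M_{>= g} with all weights >= k and all
   edges of weight k directed along tau_k. Then X_1 = M_{>= g}, and X_n is a
   point. Directing all pairs of weight <= k+1 along tau_{k+1}, with weight k+1,
   is a monotone map X_k -> X_{k+1}; its Quillen fibre over y is dominated by the
   poset of chains of subsets of A that separate prescribed pairs, all of them
   increasing for the linear order underlying y. Sweeping the vertices down in
   this order contracts that poset to a full flag. *)

Set Implicit Arguments.
Unset Strict Implicit.
Unset Printing Implicit Defensive.

Import Order.TTheory GRing.Theory Num.Theory.
Local Open Scope classical_set_scope.
Local Open Scope ring_scope.

(** * Continuity on a subset *)

(** Continuity is localized at a point because [cts_retract] needs different arguments at different
    points. *)
Definition cts_at (T U : topologicalType) (X : set T) (f : T -> U) (x : T) :=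
  f @ within X (nbhs x) --> f x.

Definition cts (T U : topologicalType) (X : set T) (f : T -> U) :=
  forall x, X x -> cts_at X f x.

Lemma ctsP (T U : topologicalType) (X : set T) (f : T -> U) :
  {within X, continuous f} <-> cts X f.
Proof. exact: subspace_continuousP. Qed.

Lemma cts_id (T : topologicalType) (X : set T) : cts X id.
Proof. by move=> x _ A; exact: cvg_within. Qed.

Lemma cts_at_cst (T U : topologicalType) (X : set T) (c : U) x :
  cts_at X (fun _ => c) x.
Proof. exact: cvg_cst. Qed.

Lemma cts_at_comp (T U V : topologicalType) (X : set T) (Y : set U)
    (f : T -> U) (g : U -> V) x :
  (forall z, X z -> Y (f z)) -> cts_at X f x -> cts_at Y g (f x) ->
  cts_at X (g \o f) x.
Proof.
move=> fXY cf cg A /cg; rewrite !nbhs_simpl /within /= => /cf.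
rewrite nbhs_simpl /within /= => AY; near=> z => Xz.
have zA : X z -> Y (f z) -> A (g (f z)) by near: z; exact: AY.
exact: zA Xz (fXY _ Xz).
Unshelve. all: by end_near. Qed.

Lemma cts_comp (T U V : topologicalType) (X : set T) (Y : set U)
    (f : T -> U) (g : U -> V) :
  (forall z, X z -> Y (f z)) -> cts X f -> cts Y g -> cts X (g \o f).
Proof.
by move=> fXY cf cg x Xx; apply: cts_at_comp (cf _ Xx) (cg _ _) => //; apply: fXY.
Qed.

Lemma cts_at_within (T U : topologicalType) (X Y : set T) (f : T -> U) x :
  X `<=` Y -> cts_at Y f x -> cts_at X f x.
Proof. by move=> XY; apply: (@cts_at_comp _ _ _ X Y id f) => // A; exact: cvg_within. Qed.

Lemma continuous_cts_at (T U : topologicalType) (X : set T) (f : T -> U) x :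
  {for x, continuous f} -> cts_at X f x.
Proof. by move=> cf; apply: cvg_trans cf; apply: cvg_app; apply: cvg_within. Qed.

Lemma cts_at_near (T U : topologicalType) (X : set T) (f g : T -> U) x :
  f x = g x -> (\forall z \near x, X z -> f z = g z) ->
  cts_at X f x -> cts_at X g x.
Proof.
rewrite /cts_at => -> fg cf A /cf; rewrite /within /= !nbhs_simpl /= => fA.
by near=> z => Xz; rewrite /= -(near fg z) //; exact: (near fA z).
Unshelve. all: by end_near. Qed.

Lemma eq_cts_at (T U : topologicalType) (X : set T) (f g : T -> U) x :
  X x -> (forall z, X z -> f z = g z) -> cts_at X f x -> cts_at X g x.
Proof. by move=> Xx fg; apply: cts_at_near; [exact: fg | exact: nearW]. Qed.

Lemma cts_at_pair (T U V : topologicalType) (X : set T) (f : T -> U) (g : T -> V) x :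
  cts_at X f x -> cts_at X g x -> cts_at X (fun z => (f z, g z)) x.
Proof. by move=> cf cg; apply: cvg_pair. Qed.

Lemma cts_at_fst (U V : topologicalType) (X : set (U * V)) x : cts_at X fst x.
Proof. by apply: continuous_cts_at; exact: cvg_fst. Qed.

Lemma cts_at_snd (U V : topologicalType) (X : set (U * V)) x : cts_at X snd x.
Proof. by apply: continuous_cts_at; exact: cvg_snd. Qed.

Section Real.
Variables (R : realType) (T : topologicalType) (X : set T).
Implicit Types (f g : T -> R) (x : T).

Lemma cts_at_ptws (P : eqType) (f : T -> {ptws P -> R}) x :
  cts_at X f x <-> forall p, cts_at X (fun z => f z p) x.
Proof.
split=> [cf p | cf].
  exact: (cvg_comp _ _ cf (@proj_continuous P (fun=> R) p (f x))).
apply/cvg_sup => p A [_ [[B Bop <-] Bfx BA]]; rewrite nbhs_filterE.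
have /cf : nbhs (f x p) B by apply: open_nbhs_nbhs.
rewrite nbhs_simpl /= => fB.
by apply: (@filterS _ (within X (nbhs x)) _ ((fun z => f z p) @^-1` B)) => // z; exact: BA.
Qed.

Lemma cts_atD f g x :
  cts_at X f x -> cts_at X g x -> cts_at X (fun z => f z + g z) x.
Proof. exact: cvgD. Qed.

Lemma cts_atB f g x :
  cts_at X f x -> cts_at X g x -> cts_at X (fun z => f z - g z) x.
Proof. exact: cvgB. Qed.

Lemma cts_atM f g x :
  cts_at X f x -> cts_at X g x -> cts_at X (fun z => f z * g z) x.
Proof. exact: cvgM. Qed.

Lemma cts_at_div f g x : g x != 0 ->
  cts_at X f x -> cts_at X g x -> cts_at X (fun z => f z / g z) x.
Proof. by move=> g0 cf cg; apply: cvgM => //; apply: cvgV. Qed.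

Lemma cts_at_max f g x :
  cts_at X f x -> cts_at X g x -> cts_at X (fun z => Num.max (f z) (g z)) x.
Proof.
move=> cf cg; rewrite /cts_at.
under eq_fun do rewrite maxr_absE.
rewrite maxr_absE; apply: cvgM; last exact: cvg_cst.
by apply: cvgD; [exact: cvgD | apply: cvg_norm; exact: cvgB].
Qed.

Lemma cts_at_min f g x :
  cts_at X f x -> cts_at X g x -> cts_at X (fun z => Num.min (f z) (g z)) x.
Proof.
move=> cf cg; rewrite /cts_at.
under eq_fun do rewrite minr_absE.
rewrite minr_absE; apply: cvgM; last exact: cvg_cst.
by apply: cvgB; [exact: cvgD | apply: cvg_norm; exact: cvgB].
Qed.

Lemma cts_at_sum (I : Type) (s : seq I) (Q : pred I) (F : I -> T -> R) x :
  (forall i, Q i -> cts_at X (F i) x) ->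
  cts_at X (fun z => \sum_(i <- s | Q i) F i z) x.
Proof.
move=> cF; elim: s => [|i s IH].
  by rewrite /cts_at; under eq_fun do rewrite big_nil; rewrite big_nil; exact: cvg_cst.
rewrite /cts_at; under eq_fun do rewrite big_cons; rewrite big_cons.
by case: ifP => // Qi; apply: cvgD; [exact: cF | exact: IH].
Qed.

(** Gives continuity at a point where one factor of a product vanishes while the other is merely
    bounded. *)
Lemma cts_at_squeeze f g x : f x = 0 -> g x = 0 ->
  (forall z, X z -> 0 <= f z <= g z) -> cts_at X g x -> cts_at X f x.
Proof.
rewrite /cts_at => -> -> fg cg.
apply: (@squeeze_cvgr _ _ _ _ (fun=> 0) g f) => //; last exact: cvg_cst.
by rewrite near_withinE; apply: nearW.
Qed.

End Real.

Lemma cts_at_local (T U : topologicalType) (X V : set T) (f : T -> U) x :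
  (\forall z \near x, X z -> V z) -> cts_at (X `&` V) f x -> cts_at X f x.
Proof.
move=> XV cf A /cf; rewrite !nbhs_simpl /within /= => fA.
near=> z => Xz.
have XVz : X z -> V z by near: z; exact: XV.
have zA : (X `&` V) z -> A (f z) by near: z; exact: fA.
by apply: zA; split => //; exact: XVz.
Unshelve. all: by end_near. Qed.

Lemma cts_at_near_lt (R : realType) (T : topologicalType) (X : set T) (f g : T -> R) x :
  cts_at X f x -> cts_at X g x -> f x < g x -> \forall z \near x, X z -> f z < g z.
Proof.
move=> cf cg fg; have /cvgr_lt/(_ 0) : cts_at X (fun z => f z - g z) x by exact: cts_atB.
rewrite subr_lt0 => /(_ fg); rewrite /within /= => lt0.
near=> z => Xz; rewrite -subr_lt0.
have : X z -> f z - g z < 0 by near: z; exact: lt0.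
exact.
Unshelve. all: by end_near. Qed.

(** * Homotopies and deformation retractions *)

Section Homotopy.
Variable R : realType.

Definition cylinder (T : topologicalType) (X : set T) : set (T * R) :=
  [set p | X p.1 /\ 0 <= p.2 <= 1].

Definition homotopic (T : topologicalType) (P : finType)
    (X : set T) (Y : set {ptws P -> R}) (f g : T -> {ptws P -> R}) :=
  exists H : T * R -> {ptws P -> R},
    [/\ cts (cylinder X) H,
        forall x (t : R), X x -> 0 <= t <= 1 -> Y (H (x, t)) &
        forall x, X x -> H (x, 0) = f x /\ H (x, 1) = g x].

Definition contractible (P : finType) (X : set {ptws P -> R}) :=
  exists2 c, X c & homotopic X X id (fun=> c).

(** Points of [X] never move. This keeps base points and boundary values fixed when maps of cubes
    are deformed. *)
Definition sdr (P : finType) (X Y : set {ptws P -> R}) :=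
  exists D : {ptws P -> R} * R -> {ptws P -> R},
    [/\ cts (cylinder Y) D,
        forall y (t : R), Y y -> 0 <= t <= 1 -> Y (D (y, t)),
        forall y, Y y -> D (y, 0) = y /\ X (D (y, 1)) &
        forall x (t : R), X x -> 0 <= t <= 1 -> D (x, t) = x].

(** Two clocks for running homotopies in succession: [early] stops at 1 at the moment t = 1/2 at
    which [late] leaves 0. *)
Definition early (t : R) := Num.min 1 (2 * t).
Definition late (t : R) := Num.max 0 (2 * t - 1).

Lemma early_late t : 0 <= t <= 1 ->
  [/\ 0 <= early t <= 1, 0 <= late t <= 1 & early t = 1 \/ late t = 0].
Proof.
move=> /andP[t0 t1]; rewrite /early /late.
by case: (leP 1 (2 * t)) => ?; case: (leP 0 (2 * t - 1)) => ?; split; lra.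
Qed.

Lemma early0 : early 0 = 0. Proof. by rewrite /early mulr0 min_r. Qed.
Lemma early1 : early 1 = 1. Proof. by rewrite /early mulr1 min_l // ler1n. Qed.
Lemma late0 : late 0 = 0. Proof. by rewrite /late mulr0 max_l //; lra. Qed.
Lemma late1 : late 1 = 1. Proof. by rewrite /late mulr1 max_r //; lra. Qed.

Lemma cts_at_early (T : topologicalType) (X : set T) (f : T -> R) x :
  cts_at X f x -> cts_at X (fun z => early (f z)) x.
Proof.
by move=> cf; apply: cts_at_min; [exact: cts_at_cst | apply: cts_atM => //; exact: cts_at_cst].
Qed.

Lemma cts_at_late (T : topologicalType) (X : set T) (f : T -> R) x :
  cts_at X f x -> cts_at X (fun z => late (f z)) x.
Proof.
move=> cf; apply: cts_at_max; first exact: cts_at_cst.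
by apply: cts_atB; [apply: cts_atM => //|]; exact: cts_at_cst.
Qed.

(* On a common domain where the maps agree, the concatenation of two homotopies
   is a sum; this avoids gluing continuous maps along closed sets. *)
Definition concat (T : Type) (P : finType)
    (H1 H2 : T * R -> {ptws P -> R}) (z : T * R) : {ptws P -> R} :=
  fun p => H1 (z.1, early z.2) p + H2 (z.1, late z.2) p - H1 (z.1, 1) p.

Section Concat.
Variables (T : topologicalType) (P : finType) (X : set T).
Variables (H1 H2 : T * R -> {ptws P -> R}).
Hypothesis H12 : forall x, X x -> H1 (x, 1) = H2 (x, 0).

Lemma concat_cases x t : X x -> 0 <= t <= 1 ->
  exists2 s, 0 <= s <= 1 & concat H1 H2 (x, t) = H1 (x, s) \/ concat H1 H2 (x, t) = H2 (x, s).
Proof.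
move=> Xx /early_late[t1 t2 [e|e]].
  exists (late t) => //; right; apply/funext => p.
  by rewrite /concat /= e addrAC subrr add0r.
exists (early t) => //; left; apply/funext => p.
by rewrite /concat /= e -(H12 Xx) addrK.
Qed.

Lemma concat0 x : X x -> concat H1 H2 (x, 0) = H1 (x, 0).
Proof. by move=> Xx; apply/funext => p; rewrite /concat /= early0 late0 -(H12 Xx) addrK. Qed.

Lemma concat1 x : concat H1 H2 (x, 1) = H2 (x, 1).
Proof. by apply/funext => p; rewrite /concat /= early1 late1 addrAC subrr add0r. Qed.

Lemma cts_concat : cts (cylinder X) H1 -> cts (cylinder X) H2 ->
  cts (cylinder X) (concat H1 H2).
Proof.
move=> c1 c2 z Xz; apply/cts_at_ptws => p.
have sub (H : T * R -> {ptws P -> R}) (s : R -> R) :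
    cts (cylinder X) H -> (forall t, 0 <= t <= 1 -> 0 <= s t <= 1) ->
    cts_at (cylinder X) (fun z => s z.2) z ->
    cts_at (cylinder X) (fun z => H (z.1, s z.2) p) z.
  move=> cH s01 cs.
  apply: (@cts_at_comp _ _ _ (cylinder X) (cylinder X) (fun z => (z.1, s z.2)) (H^~ p)).
  - by case=> x t [/= Xx t01]; split => //=; exact: s01.
  - by apply: cts_at_pair => //; exact: cts_at_fst.
  - apply/(cts_at_ptws _ H _).1; apply: cH; case: Xz => ? ?; split => //=; exact: s01.
apply: cts_atB; first apply: cts_atD.
- apply: sub => // [t /early_late[] //|]; apply: cts_at_early; exact: cts_at_snd.
- apply: sub => // [t /early_late[] //|]; apply: cts_at_late; exact: cts_at_snd.
- by apply: (sub H1 (fun=> 1)) => // [t _|]; [rewrite ler01 lexx | exact: cts_at_cst].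
Qed.

End Concat.

Lemma homotopic_eq (T : topologicalType) (P : finType) (X : set T)
    (Y : set {ptws P -> R}) f g :
  cts X f -> (forall x, X x -> Y (f x)) -> (forall x, X x -> f x = g x) ->
  homotopic X Y f g.
Proof.
move=> cf fY fg; exists (fun z => f z.1); split=> [|x t Xx _|x Xx]; last 2 first.
- exact: fY.
- by split => //=; exact: fg.
by apply: (cts_comp (f := fst) _ _ cf) => [z []|z _] //; exact: cts_at_fst.
Qed.

Lemma homotopic_trans (T : topologicalType) (P : finType) (X : set T)
    (Y : set {ptws P -> R}) f g h :
  homotopic X Y f g -> homotopic X Y g h -> homotopic X Y f h.
Proof.
move=> [H1 [c1 Y1 e1]] [H2 [c2 Y2 e2]].
have H12 x : X x -> H1 (x, 1) = H2 (x, 0) by move=> Xx; rewrite (e1 x Xx).2 (e2 x Xx).1.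
exists (concat H1 H2); split; first exact: cts_concat.
  move=> x t Xx t01; have [s s01 [->|->]] := concat_cases H12 Xx t01; [exact: Y1|exact: Y2].
move=> x Xx; rewrite (concat0 H12) // concat1.
by rewrite (e1 x Xx).1 (e2 x Xx).2.
Qed.

Lemma itv01_onem (t : R) : 0 <= t <= 1 -> 0 <= 1 - t <= 1.
Proof. by move=> /andP[t0 t1]; lra. Qed.

Lemma cts_reverse (T : topologicalType) (U : topologicalType) (X : set T) (H : T * R -> U) :
  cts (cylinder X) H -> cts (cylinder X) (fun z => H (z.1, 1 - z.2)).
Proof.
apply: cts_comp => [[x t] [/= Xx /itv01_onem]|z Xz]; first by split.
apply: cts_at_pair; first exact: cts_at_fst.
by apply: cts_atB; [exact: cts_at_cst | exact: cts_at_snd].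
Qed.

Lemma homotopic_sym (T : topologicalType) (P : finType) (X : set T)
    (Y : set {ptws P -> R}) f g :
  homotopic X Y f g -> homotopic X Y g f.
Proof.
move=> [H [cH HY e]]; exists (fun z => H (z.1, 1 - z.2)); split.
- exact: cts_reverse.
- by move=> x t Xx /itv01_onem; exact: HY.
- by move=> x Xx /=; rewrite subr0 subrr; have [] := e x Xx.
Qed.

Lemma homotopic_compl (T : topologicalType) (P P' : finType) (X : set T)
    (Y : set {ptws P -> R}) (Z : set {ptws P' -> R}) f g h :
  cts Y h -> (forall y, Y y -> Z (h y)) ->
  homotopic X Y f g -> homotopic X Z (h \o f) (h \o g).
Proof.
move=> ch hZ [H [cH HY e]]; exists (h \o H); split.
- by apply: cts_comp cH ch => -[x t] [/=]; exact: HY.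
- by move=> x t Xx t01 /=; exact/hZ/HY.
- by move=> x Xx /=; have [-> ->] := e x Xx.
Qed.

Lemma homotopic_compr (T T' : topologicalType) (P : finType) (W : set T') (X : set T)
    (Y : set {ptws P -> R}) f g h :
  cts W h -> (forall w, W w -> X (h w)) ->
  homotopic X Y f g -> homotopic W Y (f \o h) (g \o h).
Proof.
move=> ch hX [H [cH HY e]]; exists (fun z => H (h z.1, z.2)); split.
- apply: (cts_comp (f := fun z => (h z.1, z.2)) _ _ cH) => [[w t] [/= Ww t01]|z Wz].
    by split => //=; exact: hX.
  apply: cts_at_pair; last exact: cts_at_snd.
  apply: (@cts_at_comp _ _ _ (cylinder W) W fst h) => [w []||] //; first exact: cts_at_fst.
  by apply: ch; case: Wz.
- by move=> x t Ww t01; apply: HY => //; exact: hX.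
- by move=> w Ww /=; exact/e/hX.
Qed.

(** It suffices that [X] is a homotopy retract of [Y]: after the homotopy from the identity to
    [s \o t], the contraction of [Y] is transported by [t] and [s]. *)
Lemma contractible_dominated (P P' : finType) (X : set {ptws P -> R})
    (Y : set {ptws P' -> R}) (t : {ptws P -> R} -> {ptws P' -> R})
    (s : {ptws P' -> R} -> {ptws P -> R}) :
  cts X t -> (forall x, X x -> Y (t x)) ->
  cts Y s -> (forall y, Y y -> X (s y)) ->
  homotopic X X id (s \o t) -> contractible Y -> contractible X.
Proof.
move=> ct tY cs sX st [c Yc hY]; exists (s c); first exact: sX.
apply: homotopic_trans st _.
exact: (homotopic_compl cs sX (homotopic_compr ct tY hY)).
Qed.

Lemma cts_time (P : finType) (Y : set {ptws P -> R})
    (D : {ptws P -> R} * R -> {ptws P -> R}) t :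
  0 <= t <= 1 -> cts (cylinder Y) D -> cts Y (fun y => D (y, t)).
Proof.
move=> t01; apply: (cts_comp (f := fun y => (y, t))) => [y Yy|y Yy]; first by split.
by apply: cts_at_pair; [exact: cts_id | exact: cts_at_cst].
Qed.

Lemma sdr_contractible (P : finType) (X Y : set {ptws P -> R}) :
  X `<=` Y -> sdr X Y -> contractible X -> contractible Y.
Proof.
move=> XY [D [cD DY D01 DX]].
apply: (contractible_dominated (t := fun y => D (y, 1)) (s := id)) => //.
- by apply: cts_time cD; rewrite ler01 lexx.
- by move=> y /D01[].
- exact: cts_id.
- by exists D; split => // y /D01[].
Qed.

Lemma contractible_sdr (P : finType) (X Y : set {ptws P -> R}) :
  X `<=` Y -> sdr X Y -> contractible Y -> contractible X.
Proof.
move=> XY [D [cD DY D01 DX]].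
apply: (contractible_dominated (t := id) (s := fun y => D (y, 1))) => //.
- exact: cts_id.
- by apply: cts_time cD; rewrite ler01 lexx.
- by move=> y /D01[].
- by apply: homotopic_eq => //; [exact: cts_id | move=> x Xx /=; rewrite DX // ler01 lexx].
Qed.

Lemma sdr_refl (P : finType) (X : set {ptws P -> R}) : sdr X X.
Proof. by exists fst; split => // z _; exact: cts_at_fst. Qed.

Lemma sdr_trans (P : finType) (X Y Z : set {ptws P -> R}) :
  X `<=` Y -> Y `<=` Z -> sdr X Y -> sdr Y Z -> sdr X Z.
Proof.
move=> XY YZ [D [cD DY D01 DX]] [E [cE EZ E01 EY]].
pose D' (z : {ptws P -> R} * R) := D (E (z.1, 1), z.2).
have one01 : 0 <= (1 : R) <= 1 by rewrite ler01 lexx.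
have H12 z : Z z -> E (z, 1) = D' (z, 0).
  by move=> /E01[_ /D01[]].
exists (concat E D'); split.
- apply: cts_concat => //.
  apply: (cts_comp (f := fun z => (E (z.1, 1), z.2)) _ _ cD) => [[w t] [/= /E01[_ Yw] t01] //|z Wz].
  apply: cts_at_pair; last exact: cts_at_snd.
  apply: (@cts_at_comp _ _ _ (cylinder Z) Z fst (fun w => E (w, 1))) => [w []||] //.
    exact: cts_at_fst.
  by apply: cts_time cE _ _ => //; case: Wz.
- move=> z t Zz t01; have [s s01 [->|->]] := concat_cases H12 Zz t01; first exact: EZ.
  by apply: YZ; apply: DY => //; have [] := E01 z Zz.
- move=> z Zz; rewrite (concat0 H12) // concat1; have [-> Y1] := E01 z Zz.
  by split => //; have [] := D01 _ Y1.
- move=> x t Xx t01; have Zx : Z x by exact/YZ/XY.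
  have [s s01 [->|->]] := concat_cases H12 Zx t01; first by apply: EY => //; exact: XY.
  by rewrite /D' /= EY //; [exact: DX | exact: XY].
Qed.

(** The end map of [D] moves cube maps and homotopies from [Y] into [X]; it fixes the base point,
    which lies in [X], so boundary conditions survive. [D] run backwards joins the moved map to the
    original one. *)
Lemma sdr_weak_homotopy_equivalence (P : finType) (X Y : set {ptws P -> R}) :
  X `<=` Y -> sdr X Y -> weak_homotopy_equivalence R X Y id.
Proof.
move=> XY [D [cD DY D01 DX]].
have one01 : 0 <= (1 : R) <= 1 by rewrite ler01 lexx.
have cD1 : cts Y (fun y => D (y, 1)) by exact: cts_time.
split; first by apply/ctsP; exact: cts_id.
split; first by move=> _ [x Xx <-]; exact: XY.
have D_after (T : topologicalType) (W : set T) (h : T -> {ptws P -> R}) :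
    cts W h -> (forall w, W w -> Y (h w)) -> cts (cylinder W) (fun z => D (h z.1, z.2)).
  move=> ch hY; apply: (cts_comp (f := fun z => (h z.1, z.2)) _ _ cD) => [[w t] [/= Ww t01]|z Wz].
    by split => //=; exact: hY.
  apply: cts_at_pair; last exact: cts_at_snd.
  apply: (@cts_at_comp _ _ _ (cylinder W) W fst h) => [w []||] //; first exact: cts_at_fst.
  by apply: ch; case: Wz.
split=> [y Yy | x Xx k].
  have [D0 X1] := D01 y Yy; exists (D (y, 1)); split => //.
  exists (fun z => D (y, 1 - z.2)); split.
    apply/ctsP.
    have cy : cts (cube R 0) (fun=> y) by move=> w _; exact: cts_at_cst.
    exact: (cts_reverse (D_after _ (cube R 0) (fun=> y) cy (fun _ _ => Yy))).
  split; first by move=> u t _ /itv01_onem; exact: DY.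
  split; first by move=> u _; rewrite subr0 subrr; have [-> _] := D01 y Yy.
  (* The 0-dimensional cube has empty boundary, as ['I_0] has no element. *)
  by move=> u t [_ [[]]].
split=> [b [/ctsP cb [bY bx]] | a b [/ctsP ca [aX ax]] [/ctsP cb [bX bx]]].
  have bY' u : cube R k u -> Y (b u) by move=> uk; apply: bY; exists u.
  exists (fun u => D (b u, 1)); split.
    split; first by apply/ctsP; exact: (cts_comp bY' cb cD1).
    split; first by move=> _ [u uk <-]; have [] := D01 _ (bY' u uk).
    by move=> u uk; rewrite bx // DX.
  exists (fun z => D (b z.1, 1 - z.2)); split.
    by apply/ctsP; exact: (cts_reverse (D_after _ _ _ cb bY')).
  split; first by move=> u t uk /itv01_onem; apply: DY; exact: bY'.
  split; first by move=> u uk; rewrite subr0 subrr; have [-> _] := D01 _ (bY' u uk).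
  by move=> u t uk /itv01_onem t01; rewrite bx // DX.
move=> [H [/ctsP cH [HY [H01 Hx]]]]; exists (fun z => D (H z, 1)); split.
  by apply/ctsP; apply: (cts_comp _ cH cD1) => -[u t] [/=]; exact: HY.
split; first by move=> u t uk t01; have [] := D01 _ (HY u t uk t01).
split; last by move=> u t uk t01; rewrite Hx // DX.
by move=> u uk; have [-> ->] := H01 u uk; rewrite /= !DX //; [apply: bX | apply: aX]; exists u.
Qed.

End Homotopy.

(** * Order complexes *)

Definition porder_on (P : Type) (le : rel P) (S : set P) :=
  [/\ forall p, S p -> le p p,
      forall p q, S p -> S q -> le p q -> le q p -> p = q &
      forall p q r, S p -> S q -> S r -> le p q -> le q r -> le p r].

Definition monotone (P P' : Type) (le : rel P) (le' : rel P') (S : set P) (S' : set P')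
    (f : P -> P') :=
  (forall p, S p -> S' (f p)) /\
  (forall p q, S p -> S q -> le p q -> le' (f p) (f q)).

Lemma porder_onS (P : Type) (le : rel P) (S S' : set P) :
  S `<=` S' -> porder_on le S' -> porder_on le S.
Proof.
move=> SS' [r a t]; split=> [p /SS'|p q /SS' Sp /SS' Sq|p q s /SS' Sp /SS' Sq /SS' Ss].
- exact: r.
- exact: a.
- exact: t.
Qed.

Lemma porder_on_dual (P : Type) (le : rel P) (S : set P) :
  porder_on le S -> porder_on (fun p q => le q p) S.
Proof.
move=> [r a t]; split=> // [p q Sp Sq pq qp|p q s Sp Sq Ss qp sq]; first exact: a.
exact: (t s q p).
Qed.

Section Posets.
Variable R : realType.
Local Notation cs := (classifying_space R _).

Lemma classifying_space_dual (P : finType) (le : rel P) (S : set P) :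
  cs (fun p q => le q p) S = (cs le S).
Proof.
by apply/seteqP; split=> x [x0 [x1 [xS xc]]]; do 3!split => //;
  move=> p q px qx; (case: (xc p q px qx); [right|left]).
Qed.

Lemma classifying_spaceS (P : finType) (le : rel P) (S S' : set P) :
  S `<=` S' -> (cs le S) `<=` (cs le S').
Proof. by move=> SS' x [x0 [x1 [xS xc]]]; do 3!split => //; move=> p /xS/SS'. Qed.

Lemma classifying_space_nonempty (P : finType) (le : rel P) (S : set P) x :
  (cs le S) x -> exists p, S p.
Proof.
move=> [_ [x1 [xS _]]]; apply: contrapT => /forallNP noS.
have : \sum_(p : P) x p = 0.
  by rewrite big1 // => p _; apply/eqP; apply: contraT => /xS /noS.
by rewrite x1 => /eqP; rewrite oner_eq0.
Qed.

Lemma le_coord1 (P : finType) (le : rel P) (S : set P) x p :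
  (cs le S) x -> 0 <= x p <= 1.
Proof.
move=> [x0 [x1 _]]; rewrite x0 -x1 (bigD1 p) //= lerDl.
by apply: sumr_ge0.
Qed.

(** The realization of [f] in barycentric coordinates. It is defined on all functions, so that it
    also applies to the unnormalized pieces in [homotopic_push]. *)
Definition push (P P' : finType) (f : P -> P') (x : {ptws P -> R}) : {ptws P' -> R} :=
  fun q => \sum_(p | f p == q) x p.

Lemma cts_at_push (T : topologicalType) (P P' : finType) (f : P -> P') (X : set T)
    (u : T -> {ptws P -> R}) z :
  cts_at X u z -> cts_at X (fun z => push f (u z)) z.
Proof.
move=> /cts_at_ptws cu; apply/cts_at_ptws => q; rewrite /push.
by apply: cts_at_sum.
Qed.

Lemma cts_push (P P' : finType) (f : P -> P') X : cts X (push f).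
Proof. by move=> x Xx; apply: (cts_at_push (u := id)); exact: cts_id. Qed.

Lemma sum_push (P P' : finType) (f : P -> P') x : \sum_q push f x q = \sum_p x p.
Proof. by rewrite (partition_big f predT) //=. Qed.

Lemma push_neq0 (P P' : finType) (f : P -> P') x q :
  push f x q != 0 -> exists2 p, f p = q & x p != 0.
Proof.
apply: contra_neqP => /forall2NP noP; rewrite /push big1 // => p /eqP fpq.
by apply/eqP; apply: contraT => xp; case: (noP p) => //; rewrite (negbTE xp).
Qed.

Lemma push_comp (P P' P'' : finType) (f : P -> P') (g : P' -> P'') x :
  push g (push f x) = push (g \o f) x.
Proof.
apply/funext => r; rewrite /push (partition_big f (fun q => g q == r)) //=.
apply: eq_bigr => q /eqP gq; apply: eq_bigl => p.
by case: eqP => [->|//]; rewrite ?gq ?eqxx ?andbF.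
Qed.

Lemma push_id (P : finType) (x : {ptws P -> R}) : push id x = x.
Proof. by apply/funext => q; rewrite /push big_pred1_eq. Qed.

(** * Comparable monotone maps are homotopic *)

Section OrderHomotopy.
Variables (P P' : finType) (le : rel P) (le' : rel P') (S : set P) (S' : set P').
Variables (f g : P -> P').
Hypothesis poS : porder_on le S.
Hypothesis poS' : porder_on le' S'.
Hypothesis fS : monotone le le' S S' f.
Hypothesis gS : monotone le le' S S' g.
Hypothesis fg : forall p, S p -> le' (f p) (g p).

(* At time [t] the mass [t] sitting at the top of the chain supporting [x] has
   been moved: the straight-line homotopy would leave the order complex. *)
Let moved (x : P -> R) (t : R) (p : P) : R :=
  Num.min (x p) (Num.max 0 (t - \sum_(q | (q != p) && le p q) x q)).

Lemma moved_ge0 x t p : (cs le S) x -> 0 <= moved x t p.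
Proof. by move=> [x0 _]; rewrite le_min x0 le_max lexx. Qed.

Lemma moved_le x t p : moved x t p <= x p.
Proof. by rewrite ge_min lexx. Qed.

(** If some mass of [p] has moved, then [t] exceeds the mass strictly above [p], which includes that
    of [q] and of everything above [q]; so [q] has moved completely. *)
Lemma moved_top x t p q : (cs le S) x -> x p != 0 -> x q != 0 -> p != q -> le p q ->
  moved x t p != 0 -> moved x t q = x q.
Proof.
move=> [x0 [_ [xS _]]] xp xq pq lepq; have [Sp Sq] := (xS _ xp, xS _ xq).
have [_ anti trans] := poS.
rewrite /moved; set sp := \sum_(_ | _) _; set sq := \sum_(_ | _) _.
have spq : x q + sq <= sp.
  rewrite /sp (bigD1 q) /=; last by rewrite eq_sym pq.
  rewrite lerD2l /sq big_mkcond [leRHS]big_mkcond; apply: ler_sum => r _.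
  case: ifP => [/andP[rq leqr]|_]; last by case: ifP.
  have [xr|xr] := eqVneq (x r) 0; first by case: ifP; rewrite xr.
  have Sr := xS _ xr; rewrite rq andbT (trans p q r) //.
  by case: eqVneq => //= rp; move: pq; rewrite (anti p q) ?eqxx // -rp.
move=> mp; have tsp : sp < t.
  rewrite ltNge; apply: contra mp => tsp; rewrite (@max_l _ _ 0) ?subr_le0 //.
  by rewrite min_r.
apply: min_l; rewrite le_max; apply/orP; right.
by rewrite lerBrDr (le_trans spq) // ltW.
Qed.

Lemma moved0 x p : (cs le S) x -> moved x 0 p = 0.
Proof.
move=> [x0 _]; rewrite /moved max_l ?min_r // sub0r oppr_le0.
by apply: sumr_ge0.
Qed.

Lemma moved1 x p : (cs le S) x -> moved x 1 p = x p.
Proof.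
move=> [x0 [x1 _]]; apply: min_l; rewrite le_max; apply/orP; right.
rewrite lerBrDr -x1 [leRHS](bigD1 p) //= lerD2l big_mkcond [leRHS]big_mkcond.
apply: ler_sum => q _; case: ifP => [/andP[-> _]|_] //; by case: ifP.
Qed.

Lemma homotopic_push : homotopic (cs le S) (cs le' S') (push f) (push g).
Proof.
exists (fun z q => push f (fun p => z.1 p - moved z.1 z.2 p) q + push g (moved z.1 z.2) q).
split=> [z _|x t Xx t01|x Xx].
- apply/cts_at_ptws => q.
  have cx p : cts_at (cylinder (cs le S)) (fun z : {ptws P -> R} * R => z.1 p) z.
    by apply/(cts_at_ptws _ fst _).1; exact: cts_at_fst.
  have cm p : cts_at (cylinder (cs le S)) (fun z => moved z.1 z.2 p) z.
    apply: cts_at_min => //; apply: cts_at_max; first exact: cts_at_cst.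
    by apply: cts_atB; [exact: cts_at_snd | apply: cts_at_sum].
  apply: cts_atD; last exact: cts_at_sum.
  by apply: cts_at_sum => p _; exact: cts_atB.
- have [x0 [x1 [xS xc]]] := Xx.
  have [_ _ trans'] := poS'; have [fS' fle] := fS; have [gS' gle] := gS.
  have fneq0 q : push f (fun p => x p - moved x t p) q != 0 ->
      exists2 p, f p = q & x p != 0 /\ moved x t p != x p.
    move=> /push_neq0[p <- nz]; exists p => //; split; last first.
      by apply: contra nz => /eqP ->; rewrite subrr.
    apply: contra nz => /eqP xp; have := moved_le x t p; have := moved_ge0 t p Xx.
    by rewrite xp => ? ?; rewrite subr_eq0 eq_le; apply/andP.
  have gneq0 q : push g (moved x t) q != 0 ->
      exists2 p, g p = q & x p != 0 /\ moved x t p != 0.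
    move=> /push_neq0[p <- nz]; exists p => //; split => //.
    apply: contra nz => /eqP xp; have := moved_le x t p; have := moved_ge0 t p Xx.
    by rewrite xp => ? ?; rewrite eq_le; apply/andP.
  have comb q : push f (fun p => x p - moved x t p) q + push g (moved x t) q != 0 ->
      (exists2 p, f p = q & x p != 0 /\ moved x t p != x p) \/
      (exists2 p, g p = q & x p != 0 /\ moved x t p != 0).
    have [e|/fneq0 ? _] := eqVneq (push f (fun p => x p - moved x t p) q) 0; last by left.
    by rewrite e add0r => /gneq0; right.
  (* This is why mass moves from the top: by [moved_top], [q] cannot lie strictly below [p], hence
     [f p <= f q <= g q] and the new support is a chain. *)
  have cross p q : x p != 0 -> moved x t p != x p -> x q != 0 -> moved x t q != 0 ->
      le' (f p) (g q).
    move=> xp mp xq mq; have [Sp Sq] := (xS _ xp, xS _ xq).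
    have [pq|pq] := eqVneq p q; first by rewrite pq; exact: fg.
    apply: (trans' _ (f q)); [exact: fS'|exact: fS'|exact: gS'| |exact: fg].
    apply: fle => //; case: (xc p q xp xq) => // qp; move: mp.
    by rewrite (@moved_top x t q p) ?eqxx // eq_sym.
  split; [|split; [|split]].
  + move=> q; apply: addr_ge0; apply: sumr_ge0 => p _; last exact: moved_ge0.
    by rewrite subr_ge0 moved_le.
  + by rewrite big_split /= !sum_push sumrB subrK.
  + by move=> q /comb[[p <- [/xS ? _]]|[p <- [/xS ? _]]]; [exact: fS'|exact: gS'].
  + move=> q q' /comb[[p <- [xp mp]]|[p <- [xp mp]]] /comb[[p' <- [xp' mp']]|[p' <- [xp' mp']]].
    * by case: (xc p p' xp xp') => ?; [left|right]; apply: fle => //; exact: xS.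
    * by left; exact: cross.
    * by right; exact: cross.
    * by case: (xc p p' xp xp') => ?; [left|right]; apply: gle => //; exact: xS.
- split; apply/funext => q /=.
    rewrite {2}/push big1 ?addr0 => [|p _]; last exact: moved0.
    by apply: eq_bigr => p _; rewrite moved0 ?subr0.
  rewrite {1}/push big1 ?add0r => [|p _]; last by rewrite moved1 ?subrr.
  by apply: eq_bigr => p _; rewrite moved1.
Qed.

End OrderHomotopy.

Lemma push_classifying_space (P P' : finType) (le : rel P) (le' : rel P')
    (S : set P) (S' : set P') (f : P -> P') x :
  monotone le le' S S' f -> (cs le S) x -> (cs le' S') (push f x).
Proof.
move=> [fS fle] [x0 [x1 [xS xc]]]; split; [|split; [|split]].
- by move=> q; apply: sumr_ge0.
- by rewrite sum_push.
- by move=> q /push_neq0[p <- /xS]; exact: fS.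
- move=> q q' /push_neq0[p <- xp] /push_neq0[p' <- xp'].
  by case: (xc p p' xp xp') => ?; [left|right]; apply: fle => //; exact: xS.
Qed.

Lemma poset_contractible_dominated (P P' : finType) (le : rel P) (le' : rel P')
    (S : set P) (S' : set P') (t : P -> P') (s : P' -> P) :
  porder_on le S -> monotone le le' S S' t -> monotone le' le S' S s ->
  (forall p, S p -> le p (s (t p))) ->
  contractible (cs le' S') -> contractible (cs le S).
Proof.
move=> poS tm sm st; apply: (contractible_dominated (t := push t) (s := push s)).
- exact: cts_push.
- by move=> x; exact: push_classifying_space.
- exact: cts_push.
- by move=> x; exact: push_classifying_space.
- have : homotopic (cs le S) (cs le S) (push id) (push (s \o t)).
    apply: homotopic_push => //; split=> // [p /tm.1/sm.1 //|p q Sp Sq pq].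
    by apply: sm.2; [exact: tm.1|exact: tm.1|exact: tm.2].
  have -> : push id = id :> ({ptws P -> R} -> _) by apply/funext => x; exact: push_id.
  suff -> : push (s \o t) = push s \o push t by [].
  by apply/funext => x /=; rewrite push_comp.
Qed.

End Posets.

(** * Removing an element with contractible upper link *)

Section Removal.
Variables (R : realType) (P : finType) (le : rel P) (S : set P) (x : P).
Local Notation cs := (classifying_space R _).
Hypothesis poS : porder_on le S.
Hypothesis Sx : S x.

Let above : pred P := fun q => (q != x) && le x q.
Let U : set P := [set q | S q /\ above q].

Variables (c : {ptws P -> R}) (H : {ptws P -> R} * R -> {ptws P -> R}).
Hypothesis Uc : cs le U c.
Hypothesis ctsH : cts (cylinder (cs le U)) H.
Hypothesis HU : forall l (t : R), cs le U l -> 0 <= t <= 1 -> cs le U (H (l, t)).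
Hypothesis H01 : forall l, cs le U l -> H (l, 0) = l /\ H (l, 1) = c.

Let mass (y : P -> R) : R := \sum_(q | above q) y q.
Let link (y : P -> R) : {ptws P -> R} := fun q => if above q then y q / mass y else 0.
(** Without mass above [x] the link point is undefined; [c] is the limit value of the flow where the
    apex has positive mass and [late] is positive. *)
Let flow (z : {ptws P -> R} * R) : {ptws P -> R} :=
  if mass z.1 == 0 then c
  else H (link z.1, Num.min 1 (early z.2 * z.1 x / mass z.1)).

(* The part of [y] on [x] and above is a point of the cone with apex [x] over
   the link [U]. First the point of the link follows the contraction [H], up to
   time 1 as soon as the apex carries as much mass as the link; then the mass of
   the apex is transferred to the link. *)
Let retract (z : {ptws P -> R} * R) : {ptws P -> R} := fun q =>
  (if q == x then (1 - late z.2) * z.1 x else if above q then 0 else z.1 q)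
  + (mass z.1 + late z.2 * z.1 x) * flow z q.

Let S' : set P := [set q | S q /\ q != x].

Lemma above_x : above x = false.
Proof. by rewrite /above eqxx. Qed.

Lemma mass_ge0 y : cs le S y -> 0 <= mass y.
Proof. by move=> [y0 _]; exact: sumr_ge0. Qed.

Lemma link_in y : cs le S y -> mass y != 0 -> cs le U (link y).
Proof.
move=> Sy my; have [y0 [y1 [yS yc]]] := Sy; have m0 := mass_ge0 Sy.
have linkN q : link y q != 0 -> above q /\ y q != 0.
  rewrite /link; case: ifP => [_|]; last by rewrite eqxx.
  by rewrite mulf_eq0 negb_or => /andP[].
split; [|split; [|split]].
- by move=> q; rewrite /link; case: ifP => // _; exact: divr_ge0.
- by rewrite /link -big_mkcond /= -mulr_suml divff.
- by move=> q /linkN[aq /yS].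
- by move=> q r /linkN[_ yq] /linkN[_ yr]; exact: yc.
Qed.

Lemma speed01 y t : cs le S y -> 0 <= t <= 1 ->
  0 <= Num.min 1 (early t * y x / mass y) <= 1.
Proof.
move=> Sy /early_late[/andP[e0 _] _ _]; rewrite ge_min lexx andbT le_min ler01 /=.
by apply: divr_ge0; [apply: mulr_ge0 => //; case: Sy | exact: mass_ge0].
Qed.

Lemma flow_in z : cylinder (cs le S) z -> cs le U (flow z).
Proof.
move=> [Sy t01]; rewrite /flow; case: eqVneq => // my.
by apply: HU; [exact: link_in | exact: speed01].
Qed.

Lemma flow01 z q : cylinder (cs le S) z -> 0 <= flow z q <= 1.
Proof. by move=> /flow_in /le_coord1. Qed.

(** Both products vanish at time 0, and also when [y] has no mass on [x]. Where the link point
    exists, the flow then stays at it, and scaling by [mass y] restores the coordinates. *)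
Lemma retract_id y t : cs le S y -> late t * y x = 0 -> early t * y x = 0 ->
  retract (y, t) = y.
Proof.
move=> Sy lx ex; apply/funext => q; rewrite /retract /flow /= mulrBl lx ex mul0r subr0 addr0 mul1r.
rewrite min_r ?ler01 //.
have [m0|m0] := eqVneq (mass y) 0.
  rewrite m0 mul0r addr0; case: eqVneq => [-> //|qx]; case: ifP => // aq.
  have [y0 _] := Sy; apply/esym/eqP; rewrite eq_le y0 andbT -m0 /mass (bigD1 q) //= lerDl.
  by apply: sumr_ge0.
have [-> _] := H01 (link_in Sy m0); rewrite /link.
case: eqVneq => [->|qx]; first by rewrite above_x mulr0 addr0.
by case: ifP => aq; rewrite ?add0r ?mulr0 ?addr0 // mulrC divfK.
Qed.

Lemma sum_retract z : cylinder (cs le S) z -> \sum_q retract z q = 1.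
Proof.
case: z => y t yt; have [Sy t01] := yt; rewrite big_split /= -mulr_sumr.
have [_ [-> _]] := flow_in yt; rewrite mulr1.
rewrite (bigD1 x) //= eqxx (eq_bigr (fun q => if above q then 0 else y q)); last first.
  by move=> q /negbTE ->.
have [_ [y1 _]] := Sy; rewrite -[RHS]y1 [RHS](bigD1 x) //= [X in _ = _ + X](bigID above) /=.
have -> : \sum_(q | (q != x) && above q) y q = mass y.
  by apply: eq_bigl => q; rewrite /above; case: (q != x).
have -> : \sum_(i | i != x) (if above i then 0 else y i) = \sum_(i | (i != x) && ~~ above i) y i.
  by rewrite [RHS]big_mkcondr /=; apply: eq_bigr => q _; case: (above q).
by ring.
Qed.

Lemma retract_neq0 z q : retract z q != 0 ->
  [\/ q = x /\ (1 - late z.2) * z.1 x != 0, [/\ q != x, ~~ above q & z.1 q != 0]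
    | flow z q != 0].
Proof.
rewrite /retract; have [->|fq] := eqVneq (flow z q) 0; last by constructor 3.
rewrite mulr0 addr0; case: (eqVneq q x) => [->|qx]; first by constructor 1.
by case: ifP => [|aq]; rewrite ?eqxx //; constructor 2; rewrite ?aq.
Qed.

(** Support points other than [x] and not above it lie below [x], hence below the whole link; so
    they stay comparable with the flow. *)
Lemma retract_in y t : cs le S y -> 0 <= t <= 1 -> cs le S (retract (y, t)).
Proof.
move=> Sy t01; have yt : cylinder (cs le S) (y, t) by split.
(* Without mass on [x] the support may contain elements incomparable with [x], but then the
   retraction does nothing. *)
have [yx|yx] := eqVneq (y x) 0; first by rewrite retract_id // yx mulr0.
have [refl anti trans] := poS; have [y0 [y1 [yS yc]]] := Sy.
have [f0 [f1 [fU fc]]] := flow_in yt.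
have [_ /andP[l0 l1] _] := early_late t01.
have below q : q != x -> ~~ above q -> y q != 0 -> le q x.
  move=> qx; rewrite /above qx /= => /negbTE xq yq.
  by case: (yc q x yq yx) => //; rewrite xq.
have fA q : flow (y, t) q != 0 -> S q /\ le x q by move=> /fU[Sq /andP[]].
split; [|split; [exact: sum_retract|split]].
- move=> q; apply: addr_ge0; last first.
    by apply: mulr_ge0 => //; apply: addr_ge0; [exact: mass_ge0|exact: mulr_ge0].
  by case: ifP => _; [apply: mulr_ge0 => //=; rewrite subr_ge0|case: ifP].
- by move=> q /retract_neq0[[-> _] //|[_ _ /yS] //|/fA[]].
- move=> q r /retract_neq0[[-> _]|[qx qa yq]|fq] /retract_neq0[[-> _]|[rx ra yr]|fr].
  + by left; exact: refl.
  + by right; exact: below.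
  + by left; have [] := fA r fr.
  + by left; exact: below.
  + exact: yc.
  + have [Sr xr] := fA r fr; left; apply: (trans _ x) => //; [exact: yS|exact: below].
  + by right; have [] := fA q fq.
  + have [Sr xr] := fA q fq; right; apply: (trans _ x) => //; [exact: yS|exact: below].
  + exact: fc.
Qed.

Lemma retract1_in y : cs le S y -> cs le S' (retract (y, 1)).
Proof.
move=> Sy; have t01 : 0 <= (1 : R) <= 1 by rewrite ler01 lexx.
have yt : cylinder (cs le S) (y, 1 : R) by split.
have [r0 [r1 [rS rc]]] := retract_in Sy t01; split=> //; split=> //; split=> // q rq.
split; first exact: rS.
apply: contra rq => /eqP ->; have [_ [_ [fU _]]] := flow_in yt.
rewrite /retract eqxx /= late1 subrr mul0r add0r mulf_eq0; apply/orP; right.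
by apply: contraT => /fU[_]; rewrite above_x.
Qed.

Lemma cts_retract : cts (cylinder (cs le S)) retract.
Proof.
move=> z Xz; have [Sy t01] := Xz; set X := cylinder _ in Xz *.
have cy q : cts_at X (fun z : {ptws P -> R} * R => z.1 q) z.
  by apply/(cts_at_ptws _ fst _).1; exact: cts_at_fst.
have cl : cts_at X (fun z : {ptws P -> R} * R => late z.2) z.
  by apply: cts_at_late; exact: cts_at_snd.
have ce : cts_at X (fun z : {ptws P -> R} * R => early z.2) z.
  by apply: cts_at_early; exact: cts_at_snd.
have cm : cts_at X (fun z : {ptws P -> R} * R => mass z.1) z.
  by apply: cts_at_sum.
have ge0 w : X w -> [/\ 0 <= mass w.1, 0 <= w.1 x & 0 <= late w.2 <= 1].
  move=> [Sw /early_late[_ l01 _]]; split => //; first exact: mass_ge0.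
  by case: Sw.
apply/cts_at_ptws => q; apply: cts_atD.
  case: (q == x); last by case: (above q); [exact: cts_at_cst|].
  by apply: cts_atM => //; apply: cts_atB => //; exact: cts_at_cst.
have cms : cts_at X (fun z => mass z.1 + late z.2 * z.1 x) z.
  by apply: cts_atD => //; exact: cts_atM.
(* Where the mass above [x] is positive, it stays so nearby and [link] is an honest quotient. *)
have [m0|m0] := eqVneq (mass z.1) 0; last first.
  have mgt0 : 0 < mass z.1 by rewrite lt_def m0; have [] := ge0 z Xz.
  apply: cts_atM => //.
  pose V : set ({ptws P -> R} * R) := [set w | 0 < mass w.1].
  apply: (@cts_at_local _ _ _ V).
    by apply: cts_at_near_lt => //; exact: cts_at_cst.
  have XVX : X `&` V `<=` X by move=> ? [].
  apply: (@eq_cts_at _ _ _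
      (fun w : {ptws P -> R} * R => H (link w.1, Num.min 1 (early w.2 * w.1 x / mass w.1)) q)).
  - by [].
  - by move=> w [_ Vw]; rewrite /flow gt_eqF.
  - apply: (@cts_at_comp _ _ _ _ (cylinder (cs le U)) (fun w : {ptws P -> R} * R =>
      (link w.1, Num.min 1 (early w.2 * w.1 x / mass w.1))) (fun w => H w q)).
    + move=> w [[Sw tw] Vw]; split => /=; last exact: speed01.
      by apply: link_in => //; rewrite gt_eqF.
    + apply: (cts_at_within XVX); apply: cts_at_pair.
        apply/cts_at_ptws => r; rewrite /link; case: (above r); last exact: cts_at_cst.
        exact: cts_at_div.
      apply: cts_at_min; first exact: cts_at_cst.
      by apply: cts_at_div => //; exact: cts_atM.
    + apply: (cts_at_ptws _ H _).1; apply: ctsH; split => /=; last exact: speed01.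
      exact: link_in.
(* If neither [x] nor anything above it has mass, the factor in front of the bounded flow tends to
   0. *)
have [s0|s0] := eqVneq (z.1 x) 0.
  apply: (cts_at_squeeze (g := fun w : {ptws P -> R} * R => mass w.1 + w.1 x)).
  - by rewrite m0 s0 mulr0 addr0 mul0r.
  - by rewrite m0 s0 addr0.
  - move=> w Xw; have [mw sw /andP[l0 l1]] := ge0 w Xw; have /andP[f0 f1] := flow01 q Xw.
    have ls0 : 0 <= late w.2 * w.1 x by exact: mulr_ge0.
    rewrite mulr_ge0 ?addr_ge0 //=.
    apply: (@le_trans _ _ ((mass w.1 + late w.2 * w.1 x) * 1)).
      by apply: ler_wpM2l => //; exact: addr_ge0.
    by rewrite mulr1 lerD2l ler_piMl.
  - exact: cts_atD.
have sgt0 : 0 < z.1 x by rewrite lt_def s0; have [] := ge0 z Xz.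
apply: (@eq_cts_at _ _ _
  (fun w : {ptws P -> R} * R => mass w.1 * flow w q + (late w.2 * w.1 x) * flow w q)) => //.
  by move=> w _; rewrite mulrDl.
apply: cts_atD.
  apply: (cts_at_squeeze (g := fun w : {ptws P -> R} * R => mass w.1)) => //.
    by rewrite m0 mul0r.
  move=> w Xw; have [mw _ _] := ge0 w Xw; have /andP[f0 f1] := flow01 q Xw.
  by rewrite mulr_ge0 //= ler_piMr.
(* Nearby, the apex outweighs the link. When [late] is nonzero, [early] is 1, so the flow has
   reached [c]; when [late] is 0, the term vanishes. *)
apply: (@cts_at_near _ _ _ (fun w : {ptws P -> R} * R => late w.2 * w.1 x * c q)).
- by rewrite /flow m0 eqxx.
- have ms : \forall w \near z, X w -> mass w.1 < w.1 x.
    by apply: cts_at_near_lt => //; rewrite m0.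
  near=> w => Xw.
  have mw : mass w.1 < w.1 x by move: Xw; near: w; exact: ms.
  have [mw0 sw l01] := ge0 w Xw; have [Sw /early_late[_ _ el]] := Xw.
  rewrite /flow; case: eqVneq => // mwN0; case: el => [e1|->]; last by rewrite !mul0r.
  have mwgt0 : 0 < mass w.1 by rewrite lt_def mwN0.
  rewrite e1 mul1r min_l; first by have [_ ->] := H01 (link_in Sw mwN0).
  by rewrite ler_pdivlMr // mul1r ltW.
- by apply: cts_atM => //; [exact: cts_atM | exact: cts_at_cst].
Unshelve. all: by end_near. Qed.

Lemma sdr_retract : sdr (cs le S') (cs le S).
Proof.
exists retract; split; [exact: cts_retract|exact: retract_in| |].
- move=> y Sy; split; last exact: retract1_in.
  by rewrite retract_id // ?late0 ?early0 mul0r.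
- move=> y t S'y _; have Sy : cs le S y by apply: classifying_spaceS S'y => q [].
  have yx : y x = 0.
    by have [_ [_ [yS' _]]] := S'y; apply/eqP; apply: contraT => /yS'[_]; rewrite eqxx.
  by rewrite retract_id // yx mulr0.
Qed.

End Removal.

(** * Quillen's Theorem A for inclusions *)

Section QuillenInclusion.
Variable R : realType.
Local Notation cs := (classifying_space R _).

Lemma sdr_remove (P : finType) (le : rel P) (S : set P) x :
  porder_on le S -> S x ->
  contractible (cs le [set q | S q /\ (q != x) && le x q]) ->
  sdr (cs le [set q | S q /\ q != x]) (cs le S).
Proof.
move=> poS Sx [c Uc [H [cH HU H01]]].
exact: (sdr_retract poS Sx Uc cH HU H01).
Qed.

(** Induction on the size of [S]. For [x] in [S] but not in [N], the induction hypothesis retracts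
    the elements of [S] above [x] onto those of [M] above [x], so the link is contractible and [x]
    can be removed. Keeping [N] apart from [M] lets the removal stop early, as it does at the
    acyclic graphs in [theorem4]. *)
Lemma quillen_inclusion (P : finType) (le : rel P) (M N S : set P) :
  porder_on le S -> M `<=` N -> N `<=` S ->
  (forall x, S x -> ~ M x -> contractible (cs le [set q | M q /\ (q != x) && le x q])) ->
  sdr (cs le N) (cs le S).
Proof.
have [k] := ubnP #|[pred p | `[< S p >]]|.
elim: k M N S => // k IH M N S Sk poS MN NS linkM.
have [[x [Sx Nx]]|NSx] := pselect (exists x, S x /\ ~ N x); last first.
  suff -> : N = S by exact: sdr_refl.
  by apply/seteqP; split => // x Sx; apply: contrapT => Nx; apply: NSx; exists x.
have card_lt (S1 : set P) : S1 `<=` S -> ~ S1 x -> (#|[pred p | `[< S1 p >]]| < k)%N.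
  move=> S1S S1x; rewrite ltnS in Sk; apply: leq_trans Sk; apply: proper_card; apply/properP; split.
    by apply/fintype.subsetP => p; rewrite !inE; exact: S1S.
  by exists x; rewrite !inE; [|exact/asboolPn].
have Mx : ~ M x by move=> /MN.
have [_ anti trans] := poS.
pose M1 := [set q | M q /\ (q != x) && le x q].
pose S1 := [set q | S q /\ (q != x) && le x q].
pose S2 := [set q | S q /\ q != x].
have S1S : S1 `<=` S by move=> p [].
have S2S : S2 `<=` S by move=> p [].
have M1S1 : M1 `<=` S1 by move=> p [/MN/NS].
have NS2 : N `<=` S2.
  by move=> p Np; split; [exact: NS | apply: contra_notN Nx => /eqP <-].
have sdr1 : sdr (cs le M1) (cs le S1).
  apply: (IH M1) => //; [|exact: porder_onS poS|].
    by apply: card_lt => //; rewrite /S1 /= eqxx => -[].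
  move=> z [Sz /andP[zx xz]] M1z.
  have Mz : ~ M z by move=> Mz; apply: M1z; split => //; rewrite zx.
  (* Since [z] lies above [x], restricting to elements above [x] does not change what lies above
     [z]. *)
  have -> : [set q | M1 q /\ (q != z) && le z q] = [set q | M q /\ (q != z) && le z q].
    apply/seteqP; split => q [] => [[Mq _] qz|Mq /andP[qz zq]]; first by split.
    have Sq : S q by exact/NS/MN.
    split; last by rewrite qz.
    split => //; apply/andP; split; last exact: (trans x z q).
    by apply: contra zx => /eqP qx; rewrite (anti z x) // -qx.
  exact: linkM.
have sdr2 : sdr (cs le S2) (cs le S).
  apply: sdr_remove => //.
  by apply: sdr_contractible sdr1 _; [exact: classifying_spaceS | exact: linkM].
apply: sdr_trans sdr2; [exact: classifying_spaceS | exact: classifying_spaceS |].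
apply: (IH M) => //; [|exact: porder_onS poS|].
  by apply: card_lt => //; rewrite /S2 /= eqxx => -[].
by move=> z [Sz _]; exact: linkM.
Qed.

(** * Contractible fibres and the mapping cylinder *)

Section QuillenFiber.
Variables (P P' : finType) (le : rel P) (le' : rel P') (X : set P) (Y : set P') (q : P -> P').
Hypothesis poX : porder_on le X.
Hypothesis poY : porder_on le' Y.
Hypothesis qXY : monotone le le' X Y q.
Hypothesis fib : forall y, Y y -> contractible (cs le [set x | X x /\ le' (q x) y]).

(** The order of the non-Hausdorff mapping cylinder of [q], with [Y] placed on top. *)
Let cyl_le : rel (P + P') := fun a b =>
  match a, b with
  | inl x, inl x' => le x x'
  | inl x, inr y => le' (q x) y
  | inr y, inr y' => le' y y'
  | inr _, inl _ => false
  end.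
Let cyl : set (P + P') := fun a => match a with inl x => X x | inr y => Y y end.
Let base : set (P + P') := fun a => match a with inl x => X x | inr y => False end.

Lemma porder_on_cyl : porder_on cyl_le cyl.
Proof.
have [rX aX tX] := poX; have [rY aY tY] := poY; have [qX qle] := qXY.
split.
- by case=> [x|y] /=; [exact: rX | exact: rY].
- by case=> [x|y] [x'|y'] //= *; congr (_ _); [exact: aX | exact: aY].
- case=> [x|y] [x'|y'] [x''|y''] //=; [exact: tX| | |exact: tY].
    move=> Xx Xx' Yy xx'; apply: tY => //; [exact: qX|exact: qX|exact: qle].
  by move=> Xx Yy' Yy''; apply: tY => //; exact: qX.
Qed.

(** The cylinder is dominated by [Y], since [x] lies below [q x]. The elements of [Y] can be removed
    from it, because the part of [X] below each [y] is the fibre over [y]; what remains is [X]. *)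
Lemma quillen_fiber : contractible (cs le' Y) -> contractible (cs le X).
Proof.
have [rX aX tX] := poX; have [rY aY tY] := poY; have [qX qle] := qXY.
move=> cY.
have [x0 _] : exists x, X x.
  have [y0 /classifying_space_nonempty[y Yy] _] := cY.
  by have [z /classifying_space_nonempty[x []]] := fib Yy; exists x.
pose p (a : P + P') := if a is inl x then x else x0.
have base_cyl : base `<=` cyl by case.
have poB := porder_onS base_cyl porder_on_cyl.
have sdrB : sdr (cs cyl_le base) (cs cyl_le cyl).
  (* [quillen_inclusion] works with upper links; reversing the order turns the fibre below [y] into
     one. *)
  rewrite -classifying_space_dual -[X in sdr _ X]classifying_space_dual.
  apply: (quillen_inclusion (M := base)) => //; first exact/porder_on_dual/porder_on_cyl.
  case=> [x|y] //= Yy _; rewrite (classifying_space_dual _ cyl_le).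
  apply: (poset_contractible_dominated (t := p) (s := inl)) (fib Yy).
  - by apply: porder_onS poB => a [].
  - split=> [[x|y'] [] //= Xx /andP[_ ?] //|].
    by case=> [x|y'] [x'|y''] [Xx _] [Xx' _].
  - by split=> [x [Xx qxy]|].
  - by case=> [x|y'] [] //= Xx _; exact: rX.
have cB : contractible (cs cyl_le base).
  apply: contractible_sdr sdrB _; first exact: classifying_spaceS.
  apply: (poset_contractible_dominated
    (t := fun a => match a with inl x => q x | inr y => y end) (s := inr)) cY.
  - exact: porder_on_cyl.
  - split=> [[x|y] //=|]; first exact: qX.
    by case=> [x|y] [x'|y'] //=; exact: qle.
  - by split.
  - by case=> [x|y] /= ?; apply: rY => //; exact: qX.
apply: (poset_contractible_dominated (t := inl) (s := p)) cB => //.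
split=> [[x|y] //|]; by case=> [x|y] [x'|y'].
Qed.

End QuillenFiber.

End QuillenInclusion.

(** * Chains of cuts *)

Section Vertices.
Variables (R : realType) (P : finType) (le : rel P) (S : set P).
Hypothesis poS : porder_on le S.
Local Notation cs := (classifying_space R _).

Lemma contractible_const p : S p ->
  homotopic (cs le S) (cs le S) (push id) (push (fun=> p)) -> contractible (cs le S).
Proof.
move=> Sp [H [cH HS H01]].
have vertex : cs le S (fun q => (q == p)%:R).
  have [refl _ _] := poS; split; [|split; [|split]].
  - by move=> q; rewrite ler0n.
  - by rewrite (bigD1 p) //= eqxx big1 ?addr0 // => q /negbTE ->.
  - by move=> q; case: (eqVneq q p) => [-> //|_]; rewrite eqxx.
  - move=> q r; case: (eqVneq q p) => [->|_]; last by rewrite eqxx.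
    by case: (eqVneq r p) => [->|_]; [left; exact: refl | rewrite eqxx].
exists (fun q => (q == p)%:R) => //; exists H; split => // x Sx.
have [-> ->] := H01 x Sx; split; first exact: push_id.
have [_ [x1 _]] := Sx; apply/funext => q; rewrite /push.
by case: (eqVneq p q) => _; rewrite ?x1 ?big_pred0_eq.
Qed.

Lemma contractible_max p : S p -> (forall q, S q -> le q p) -> contractible (cs le S).
Proof.
move=> Sp maxp; apply: (contractible_const Sp).
have [refl _ _] := poS.
apply: (@homotopic_push R _ _ le le S S id (fun=> p) poS poS) => //.
by split => // *; exact: refl.
Qed.

End Vertices.

Section Cuts.
Variables (R : realType) (A : finType) (C : rel A) (rk : A -> nat) (N : nat).
Hypothesis rkC : forall a b, C a b -> (rk a < rk b)%N.
Hypothesis rkN : forall a, (rk a < N)%N.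
Implicit Types (s : {set {set A}}) (I J K : {set A}).

Definition cuts_le : rel {set {set A}} := fun s s' => s \subset s'.

Definition cut_chain : set {set {set A}} := fun s =>
  (forall I J, I \in s -> J \in s -> I \subset J \/ J \subset I) /\
  (forall a b, C a b -> exists I, [/\ I \in s, a \in I & b \notin I]).

Lemma porder_on_cuts (S : set {set {set A}}) : porder_on cuts_le S.
Proof.
split=> [s _|s s' _ _ ss' s's|s s' s'' _ _ _]; first exact: fintype.subxx.
  by apply/eqP; rewrite finset.eqEsubset; apply/andP.
exact: fintype.subset_trans.
Qed.

Definition initial j : {set A} := finset (fun a => (rk a < j)%N).

(* [push_down j u v] intersects the small sets with [initial j] and the large
   ones with [initial j.+1]; for u = v + 1 both versions of a set of size v
   occur, and they are comparable. *)
Definition push_down j u v s : {set {set A}} := finset (fun K =>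
  [exists I in s, ((K == I :&: initial j) && (#|I :&: initial j| < u)%N)
               || ((K == I :&: initial j.+1) && (v <= #|I :&: initial j|)%N)]
  || [exists i : 'I_N.+1, (j < i)%N && (K == initial i)]).

Lemma in_initial a j : (a \in initial j) = (rk a < j)%N.
Proof. exact: finset.in_set. Qed.

Lemma initialS i j : (i <= j)%N -> initial i \subset initial j.
Proof. by move=> ij; apply/fintype.subsetP => a; rewrite !in_initial => /leq_trans; apply. Qed.

Lemma push_downP j u v s K : reflect
  [\/ exists I, [/\ I \in s, (#|I :&: initial j| < u)%N & K = I :&: initial j],
      exists I, [/\ I \in s, (v <= #|I :&: initial j|)%N & K = I :&: initial j.+1] |
      exists i, [/\ (i <= N)%N, (j < i)%N & K = initial i]]
  (K \in push_down j u v s).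
Proof.
rewrite finset.in_set; apply: (iffP orP) => [[/exists_inP[I Is /orP[]/andP[/eqP -> ?]]|]|].
- by constructor 1; exists I.
- by constructor 2; exists I.
- by move=> /existsP[i /andP[ji /eqP ->]]; constructor 3; exists i; split => //; rewrite -ltnS.
- case=> [[I [Is Iu ->]]|[I [Is Iv ->]]|[i [iN ji ->]]].
  + by left; apply/exists_inP; exists I => //; rewrite eqxx Iu.
  + by left; apply/exists_inP; exists I => //; rewrite eqxx Iv orbT.
  + by right; apply/existsP; exists (Ordinal (iN : (i < N.+1)%N)); rewrite /= ji eqxx.
Qed.

(** A pair with [C a b] stays separated: by [initial (rk b)] if [rk b] exceeds [j], and otherwise by
    a truncation of an old cut, since [a] then has rank below [j]. *)
Lemma push_down_in j u v s :
  (v <= u)%N -> (u <= v.+1)%N -> cut_chain s -> cut_chain (push_down j u v s).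
Proof.
move=> vu uv [chain sep]; split.
  (* Only the case of [J] inside [I] needs care: the truncations to [initial j] then have sizes at
     least [v] and below [u <= v + 1], so they coincide. *)
  have XY I J : I \in s -> J \in s -> (#|I :&: initial j| < u)%N ->
      (v <= #|J :&: initial j|)%N ->
      I :&: initial j \subset J :&: initial j.+1 \/ J :&: initial j.+1 \subset I :&: initial j.
    move=> Is Js Iu Jv; left; case: (chain I J Is Js) => IJ.
      by apply: finset.setISS => //; exact: initialS.
    have JIj : J :&: initial j \subset I :&: initial j by exact: finset.setSI.
    have -> : I :&: initial j = J :&: initial j.
      apply/esym/eqP; rewrite eqEcard JIj /=.
      by rewrite (leq_trans _ Jv) // -ltnS (leq_trans Iu).
    by apply: finset.setIS; exact: initialS.
  have top I k i : (k <= j.+1)%N -> (j < i)%N -> I :&: initial k \subset initial i.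
    move=> kj ji; apply: fintype.subset_trans (finset.subsetIr _ _) _.
    by apply: initialS; exact: leq_trans ji.
  move=> _ _ /push_downP[[I [Is Iu ->]]|[I [Is Iv ->]]|[i [iN ji ->]]]
    /push_downP[[J [Js Ju ->]]|[J [Js Jv ->]]|[i' [i'N ji' ->]]].
  - by case: (chain I J Is Js) => IJ; [left|right]; exact: finset.setSI.
  - exact: XY.
  - by left; apply: top.
  - by case: (XY J I Js Is Ju Iv); [right|left].
  - by case: (chain I J Is Js) => IJ; [left|right]; exact: finset.setSI.
  - by left; apply: top.
  - by right; apply: top.
  - by right; apply: top.
  - by case/orP: (leq_total i i') => ?; [left|right]; exact: initialS.
move=> a b Cab; have ab := rkC Cab.
have [jb|bj] := ltnP j (rk b).
  exists (initial (rk b)); rewrite !in_initial ab ltnn; split => //.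
  by apply/push_downP; constructor 3; exists (rk b); split => //; exact/ltnW/rkN.
have aj : (rk a < j)%N by exact: leq_trans bj.
have [I [Is aI bI]] := sep a b Cab.
have [Iu|uI] := ltnP #|I :&: initial j| u.
  exists (I :&: initial j); rewrite !finset.in_setI aI (negbTE bI) in_initial aj; split => //.
  by apply/push_downP; constructor 1; exists I.
exists (I :&: initial j.+1); rewrite !finset.in_setI aI (negbTE bI) in_initial ltnW //.
by split => //; apply/push_downP; constructor 2; exists I; split => //; exact: leq_trans uI.
Qed.

Lemma push_downS j u v s s' :
  s \subset s' -> push_down j u v s \subset push_down j u v s'.
Proof.
move=> /fintype.subsetP ss'; apply/fintype.subsetP => K.
move=> /push_downP[[I [/ss' ? ? ?]]|[I [/ss' ? ? ?]]|].
- by apply/push_downP; constructor 1; exists I.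
- by apply/push_downP; constructor 2; exists I.
- by move=> ?; apply/push_downP; constructor 3.
Qed.

Lemma push_down_mono j u v : (v <= u)%N -> (u <= v.+1)%N ->
  monotone cuts_le cuts_le cut_chain cut_chain (push_down j u v).
Proof. by move=> vu uv; split=> [s|s s' _ _]; [exact: push_down_in | exact: push_downS]. Qed.

(** A zigzag of pointwise comparable maps leads from the identity to a constant. For fixed [j], cuts
    are truncated from [initial j.+1] to [initial j] in order of size as [u] grows; then [j] drops
    by one. *)
Lemma contractible_cut_chain :
  contractible (classifying_space R _ cuts_le cut_chain).
Proof.

pose hm (f g : {set {set A}} -> {set {set A}}) :=
  homotopic (classifying_space R _ cuts_le cut_chain)
    (classifying_space R _ cuts_le cut_chain) (push f) (push g).
have po := porder_on_cuts cut_chain.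
have hm_le f g : monotone cuts_le cuts_le cut_chain cut_chain f ->
    monotone cuts_le cuts_le cut_chain cut_chain g ->
    (forall s, cut_chain s -> f s \subset g s) -> hm f g.
  by move=> mf mg fg; exact: (@homotopic_push R _ _ _ _ _ _ f g po po).
have step j u : hm (push_down j u u) (push_down j u.+1 u.+1).
  apply: (@homotopic_trans _ _ _ _ _ _ (push (push_down j u.+1 u))).
    apply: hm_le; [exact: push_down_mono | exact: push_down_mono|].
    move=> s _; apply/fintype.subsetP => K /push_downP[[I [Is Iu ->]]|?|?]; apply/push_downP.
    - by constructor 1; exists I; split => //; exact: ltnW.
    - by constructor 2.
    - by constructor 3.
  apply: homotopic_sym.
  apply: hm_le; [exact: push_down_mono | exact: push_down_mono|].
  move=> s _; apply/fintype.subsetP => K /push_downP[?|[I [Is Iu ->]]|?]; apply/push_downP.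
  - by constructor 1.
  - by constructor 2; exists I; split => //; exact: ltnW.
  - by constructor 3.
have level j u : hm (push_down j 0 0) (push_down j u u).
  elim: u => [|u IH]; last exact: homotopic_trans IH (step j u).
  by apply: hm_le => //; exact: push_down_mono.
have cardS I : (#|I| < #|A|.+1)%N by rewrite ltnS max_card.
(* Once [u] exceeds [#|A|], every cut has been truncated. Passing to the next lower level then adds
   at most the set [initial j.+1]. *)
have next j : hm (push_down j.+1 #|A|.+1 #|A|.+1) (push_down j 0 0).
  apply: hm_le; [exact: push_down_mono | exact: push_down_mono|].
  move=> s _; apply/fintype.subsetP => K /push_downP[[I [Is _ ->]]|[I [Is]]|[i [iN ji ->]]].
  - by apply/push_downP; constructor 2; exists I.
  - by rewrite leqNgt cardS.
  - by apply/push_downP; constructor 3; exists i; split => //; exact: ltnW.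
pose flag : {set {set A}} := finset (fun K => [exists i : 'I_N.+1, K == initial i]).
have flagP i : (i <= N)%N -> initial i \in flag.
  by move=> iN; rewrite finset.in_set; apply/existsP; exists (Ordinal (iN : (i < N.+1)%N)).
have Wflag : cut_chain flag.
  split=> [I J|a b Cab].
    rewrite !finset.in_set => /existsP[i /eqP ->] /existsP[k /eqP ->].
    by case/orP: (leq_total i k) => ?; [left|right]; exact: initialS.
  exists (initial (rk b)); split; rewrite ?in_initial ?ltnn ?rkC //; apply: flagP; exact/ltnW/rkN.
apply: (contractible_const po Wflag).
have down j : hm (push_down j 0 0) (push_down 0 #|A|.+1 #|A|.+1).
  elim: j => [|j IH]; first exact: level.
  apply: homotopic_trans (level j.+1 #|A|.+1) _.
  exact: homotopic_trans (next j) IH.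
apply: (@homotopic_trans _ _ _ _ _ _ (push (push_down N 0 0))).
  apply: hm_le; [by [] | exact: push_down_mono |].
  (* All ranks are below [N], so truncation to [initial N.+1] changes nothing. *)
  move=> s _; apply/fintype.subsetP => I Is; apply/push_downP; constructor 2; exists I; split => //.
  by apply/esym/finset.setIidPl/fintype.subsetP => a _; rewrite in_initial ltnS ltnW.
apply: homotopic_trans (down N) _.
apply: hm_le; [exact: push_down_mono | by split=> // *; exact: fintype.subxx |].
move=> s _; apply/fintype.subsetP => K /push_downP[[I [Is _ ->]]|[I [Is]]|[i [iN _ ->]]].
- suff -> : I :&: initial 0 = initial 0 by exact: flagP.
  by apply/finset.setIidPr/fintype.subsetP => a; rewrite in_initial ltn0.
- by rewrite leqNgt cardS.
- exact: flagP.
Qed.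

End Cuts.

(** * Posets of graphs *)

Local Close Scope ring_scope.
Local Open Scope nat_scope.

(** The number of ancestors increases strictly along edges, as there is no cycle; ties are broken by
    [enum_rank], used as the low digit in base [#|A|]. *)
Lemma acyclic_linear_extension (A : finType) (e : rel A) :
  (forall s : seq A, s != [::] -> ~~ cycle e s) ->
  exists2 rk : A -> nat, injective rk & forall a b, e a b -> rk a < rk b.
Proof.
move=> acyc; pose ht a := #|[pred x | connect e x a]|.
have ht_lt a b : e a b -> ht a < ht b.
  move=> eab; apply: proper_card; apply/properP; split.
    apply/fintype.subsetP => x; rewrite !inE => xa.
    exact: connect_trans xa (connect1 eab).
  exists b; rewrite !inE ?connect0 //.
  apply/negP => /connectP[p pb pa].
  have /negP[] := acyc (b :: p) isT.
  by rewrite /= rcons_path pb -pa.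
have lt_rank (x : A) : enum_rank x < #|A| by [].
exists (fun a => ht a * #|A| + enum_rank a) => [a b|a b /ht_lt].
  move=> /(congr1 (modn^~ #|A|)); rewrite !modnMDl !modn_small // => eab.
  exact/enum_rank_inj/val_inj.
rewrite -(leq_pmul2r (m := #|A|)); last exact: leq_ltn_trans (lt_rank a).
by have := lt_rank a; rewrite mulSn; lia.
Qed.

Section Graphs.
Variables (n : nat) (A : finType).
Implicit Types (g h : graph n A).

Definition graph_of (f : A -> A -> nat) : graph n A := [ffun p => inord (f p.1 p.2)].

Lemma wgt_graph_of f a b : f a b <= n -> wgt (graph_of f) a b = f a b.
Proof. by move=> fn; rewrite /wgt ffunE inordK. Qed.

Lemma wgt_le g a b : wgt g a b <= n.
Proof. by rewrite /wgt -ltnS. Qed.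

Lemma eq_graph g h : (forall a b, wgt g a b = wgt h a b) -> g = h.
Proof. by move=> gh; apply/ffunP => -[a b]; apply: val_inj; exact: gh. Qed.

(** Stated with sums and zero values so that [lia] can settle case distinctions on weights. *)
Lemma wf_graphP g : reflect
  ((forall a, wgt g a a = 0) /\
   (forall a b, wgt g a b = 0 \/ wgt g b a = 0) /\
   (forall a b, a = b \/ 0 < wgt g a b + wgt g b a))
  (wf_graph g).
Proof.
apply: (iffP andP) => [[/forallP g0 /forallP gN]|[g0 [gas gtot]]].
  split; first by move=> a; apply/eqP.
  split=> a b; have [<-|ab] := eqVneq a b; rewrite ?(eqP (g0 a)); try by left.
    by move: (gN a) => /forallP/(_ b); rewrite ab /=; lia.
  by move: (gN a) => /forallP/(_ b); rewrite ab /=; lia.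
split; first by apply/forallP => a; rewrite g0.
apply/forallP => a; apply/forallP => b; apply/implyP => /eqP ab.
by have := gas a b; case: (gtot a b) => // ?; lia.
Qed.

Lemma graph_leP g h : wf_graph g -> reflect
  (forall a b, 0 < wgt g a b -> wgt g a b <= wgt h a b \/ wgt g a b < wgt h b a)
  (graph_le g h).
Proof.
move=> /wf_graphP[g0 _]; apply: (iffP forallP) => [gh a b gab|gh a].
  have ab : a != b by apply: contraTneq gab => ->; rewrite g0.
  by move: (gh a) => /forallP/(_ b); rewrite ab gab /=; lia.
apply/forallP => b; apply/implyP => /andP[_ gab].
by have := gh a b gab; lia.
Qed.

Lemma porder_on_graphs (S : set (graph n A)) :
  (forall g, S g -> wf_graph g) -> porder_on (@graph_le n A) S.
Proof.
move=> wfS; split.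
- by move=> g Sg; apply/(graph_leP _ (wfS g Sg)) => a b _; left.
- move=> g h Sg Sh /(graph_leP _ (wfS g Sg)) gh /(graph_leP _ (wfS h Sh)) hg.
  have /wf_graphP[g0 [gas gt]] := wfS g Sg; have /wf_graphP[h0 [has ht]] := wfS h Sh.
  apply: eq_graph => a b; have [<-|ab] := gt a b; first by rewrite g0 h0.
  have := gh a b; have := gh b a; have := hg a b; have := hg b a.
  by have := gas a b; have := has a b; lia.
- move=> g h k Sg Sh Sk /(graph_leP _ (wfS g Sg)) gh /(graph_leP _ (wfS h Sh)) hk.
  apply/(graph_leP _ (wfS g Sg)) => a b gab.
  by have := gh a b gab; have := hk a b; have := hk b a; lia.
Qed.

(** A reversed edge has weight 0, so this ultrametric inequality constrains directions as well as
    weights. *)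
Definition layered g := forall a b c, wgt g a c <= maxn (wgt g a b) (wgt g b c).

Definition cells : set (graph n A) := [set g | wf_graph g /\ layered g].

Lemma Gn_sub_Gn_ext : @Gn n A `<=` @Gn_ext n A.
Proof.
move=> g [wfg acyc]; split => // k s s0; apply: contra (acyc s s0).
by apply: sub_cycle => a b; rewrite /edge_w /edge => /andP[k0 /eqP ->].
Qed.

(** Applied along [c], [b], [a], the inequality makes the weight from [c] to [a] zero, so the edge
    runs from [a] to [c]. *)
Lemma edge_trans g : cells g -> transitive (edge g).
Proof.
move=> [/wf_graphP[g0 [gas gt]] lg] b a c; rewrite /edge => ab bc.
have [ac|] := gt a c; first by have := gas a b; rewrite ac in ab *; lia.
by have := lg c b a; have := gas a b; have := gas b c; lia.
Qed.

Lemma cells_sub_Gn : cells `<=` @Gn n A.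
Proof.
move=> g cg; have [wfg lg] := cg; have /wf_graphP[g0 _] := wfg.
split=> // -[//|a s] _; apply/negP => /= /(order_path_min (@edge_trans g cg)).
by rewrite all_rcons => /andP[]; rewrite /edge g0.
Qed.

(** * Replacing the light edges of a graph *)

Section Merge.
Variables (K : nat) (y : graph n A) (f : A -> A -> nat).
Hypothesis fK : forall a b, f a b <= K.
Hypothesis fn : forall a b, f a b <= n.

Definition strong a b := (K < wgt y a b) || (K < wgt y b a).

Definition merge := graph_of (fun a b => if strong a b then wgt y a b else f a b).

Lemma strongC a b : strong a b = strong b a.
Proof. exact: orbC. Qed.

Lemma strongN a b : ~~ strong a b = (wgt y a b <= K) && (wgt y b a <= K).
Proof. by rewrite /strong negb_or -!leqNgt. Qed.

Lemma wgt_merge a b : wgt merge a b = if strong a b then wgt y a b else f a b.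
Proof. by rewrite wgt_graph_of //; case: ifP => // _; exact: wgt_le. Qed.

Lemma merge_wf : wf_graph y -> (forall a, f a a = 0) ->
  (forall a b, f a b = 0 \/ f b a = 0) -> (forall a b, a = b \/ 0 < f a b + f b a) ->
  wf_graph merge.
Proof.
move=> /wf_graphP[y0 [yas ytot]] f0 fas ftot; apply/wf_graphP; split.
  by move=> a; rewrite wgt_merge y0 f0 if_same.
by split=> a b; rewrite !wgt_merge (strongC b a); case: ifP.
Qed.

Lemma merge_layered : wf_graph y -> layered y ->
  (forall a b c, f a c <= maxn (f a b) (f b c)) -> layered merge.
Proof.
move=> /wf_graphP[_ [yas _]] ly lf a b c; rewrite !wgt_merge /strong.
have [Lac|Lac] := ltnP K (wgt y a c).
  rewrite /=; have := ly a b c; case: (leqP (wgt y a b) (wgt y b c)) => bc.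
    move=> ac; rewrite (leq_trans Lac ac) /=.
    by rewrite leq_max ac orbT.
  move=> ac; rewrite (leq_trans Lac ac) /=.
  by rewrite leq_max ac.
have [Lca|Lca] := ltnP K (wgt y c a).
  by rewrite /=; case: (yas a c) => e; [rewrite e | move: Lca; rewrite e].
rewrite /= leq_max.
have [Lab|Lab] /= := ltnP K (wgt y a b).
  by rewrite (leq_trans (fK a c) (ltnW Lab)).
have [Lbc|Lbc] /= := ltnP K (wgt y b c).
  by rewrite (leq_trans (fK a c) (ltnW Lbc)) orbT.
(* When neither [a] to [b] nor [b] to [c] is heavy, the inequality for [y] makes the reversed edges
   light too, so the whole triangle is governed by [f]. *)
rewrite !ltnNge.
have -> /= : wgt y b a <= K by apply: leq_trans (ly b c a) _; rewrite geq_max Lbc.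
have -> /= : wgt y c b <= K by apply: leq_trans (ly c a b) _; rewrite geq_max Lca.
by rewrite -leq_max.
Qed.

End Merge.

(** * Strata of the layered graphs above [g] *)

Section Above.
Variables (g : graph n A) (tau : nat -> A -> nat).
Hypothesis tau_inj : forall k, injective (tau k).
Hypothesis tau_edge : forall k a b, 0 < k -> wgt g a b = k -> tau k a < tau k b.

(** This is [X_k]: its pairs of the least allowed weight [k] leave no choice of direction. *)
Definition stratum k : set (graph n A) := [set h | [/\ wf_graph h, layered h, graph_le g h &
  forall a b, 0 < wgt h a b -> k <= wgt h a b /\ (wgt h a b = k -> tau k a < tau k b)]].

Hypothesis wfg : wf_graph g.

Lemma stratum_wf k h : stratum k h -> wf_graph h.
Proof. by case. Qed.

Lemma porder_on_stratum k (S : set (graph n A)) :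
  S `<=` stratum k -> porder_on (@graph_le n A) S.
Proof. by move=> Sk; apply: porder_on_graphs => h /Sk/stratum_wf. Qed.

Lemma tau_total k a b : [\/ a = b, tau k a < tau k b | tau k b < tau k a].
Proof.
by case: (ltngtP (tau k a) (tau k b)) => [? | ? | /tau_inj ?];
  [constructor 2 | constructor 3 | constructor 1].
Qed.

Definition flat k a b := if tau k a < tau k b then k else 0.

Lemma flat_wf k : 0 < k ->
  [/\ forall a, flat k a a = 0, forall a b, flat k a b = 0 \/ flat k b a = 0 &
      forall a b, a = b \/ 0 < flat k a b + flat k b a].
Proof.
move=> k0; rewrite /flat; split=> [a|a b|a b]; first by rewrite ltnn.
  by case: (ltngtP (tau k a) (tau k b)); auto.
by case: (tau_total k a b) => [->|->|->]; [left|right; lia|right; lia].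
Qed.

Lemma flat_layered k a b c : flat k a c <= maxn (flat k a b) (flat k b c).
Proof. by rewrite /flat; do !case: ifP; lia. Qed.

Lemma flat_le k a b : flat k a b <= k.
Proof. by rewrite /flat; case: ifP. Qed.

(** An edge of [g] of weight below [k] lies under weight [k] in either direction; one of weight
    exactly [k] is directed along [tau k] by [tau_edge]. *)
Lemma flat_ge k a b : 0 < k -> 0 < wgt g a b <= k ->
  wgt g a b <= flat k a b \/ wgt g a b < flat k b a.
Proof.
move=> k0 /andP[gab gk]; rewrite /flat; case: (tau_total k a b) => [ab|->|tba]; [|by left|].
  by have /wf_graphP[g0 _] := wfg; move: gab; rewrite ab g0.
have /eqP : wgt g a b != k by apply/eqP => /(tau_edge k0); lia.
by rewrite tba; lia.
Qed.

(** Its values on layered graphs above [g] lie in [stratum k], so the map from [stratum k] to the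
    next stratum is [collapse k.+1]. *)
Definition collapse k h := merge k h (flat k).

Lemma wgt_collapse k h a b : k <= n -> wgt (collapse k h) a b =
  if strong k h a b then wgt h a b else flat k a b.
Proof. by move=> kn; rewrite wgt_merge // => x y; exact: leq_trans (flat_le _ _ _) kn. Qed.

Lemma collapse_in k h : 0 < k <= n -> wf_graph h -> layered h -> graph_le g h ->
  stratum k (collapse k h).
Proof.
move=> /andP[k0 kn] wfh lh /(graph_leP _ wfg) gh.
have wE a b := wgt_collapse h a b kn.
have fn a b : flat k a b <= n by exact: leq_trans (flat_le _ _ _) kn.
have [f0 fas ftot] := flat_wf k0.
split.
- exact: merge_wf.
- by apply: merge_layered => //; [exact: flat_le | exact: flat_layered].
- apply/(graph_leP _ wfg) => a b gab; rewrite !wE (strongC k h b a).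
  have := gh a b gab; case: ifP => // /negbT; rewrite strongN => /andP[hab hba] ghab.
  by apply: flat_ge => //; lia.
- move=> a b; rewrite wE; case: ifP; last by rewrite /flat; case: ifP.
  by have /wf_graphP[_ [has _]] := wfh; rewrite /strong; have := has a b; lia.
Qed.

Lemma collapse_mono k h h' : k <= n -> wf_graph h -> wf_graph (collapse k h) ->
  graph_le h h' -> graph_le (collapse k h) (collapse k h').
Proof.
move=> kn wfh wfc /(graph_leP _ wfh) hh'; apply/(graph_leP _ wfc) => a b.
rewrite !wgt_collapse // !(strongC k _ b a).
have := hh' a b; have := hh' b a; have := flat_le k a b.
have /wf_graphP[_ [has _]] := wfh; have := has a b; rewrite /strong.
case: ifP => hs; case: ifP => h's; lia.
Qed.

(** Weights in [stratum k] are at least [k], so a pair without a heavier edge has weight exactly [k]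
    and follows [tau k]. *)
Lemma stratum_flat k h a b : 0 < k -> stratum k h -> ~~ strong k h a b ->
  wgt h a b = flat k a b.
Proof.
move=> k0 [wfh _ _ hk]; rewrite strongN => /andP[hab hba].
have /wf_graphP[h0 [has htot]] := wfh; rewrite /flat.
have := hk a b; have := hk b a; have := has a b.
by case: (htot a b) => [<-|]; [rewrite h0 !ltnn | case: ifP; lia].
Qed.

(** No weight exceeds [n], so by [stratum_flat] the graph [top] is the only element. *)
Lemma contractible_stratum_top (R : realType) : 0 < n ->
  contractible (classifying_space R _ (@graph_le n A) (stratum n)).
Proof.
move=> n0; have nn : 0 < n <= n by rewrite n0 leqnn.
have weak h a b : ~~ strong n h a b by rewrite strongN !wgt_le.
pose top := graph_of (flat n).
have wE a b : wgt top a b = flat n a b by rewrite wgt_graph_of // flat_le.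
have [f0 fas ftot] := flat_wf n0.
have Stop : stratum n top.
  have -> : top = collapse n top.
    by apply: eq_graph => a b; rewrite wgt_collapse // (negbTE (weak _ _ _)).
  apply: collapse_in => //.
  - by apply/wf_graphP; split; [|split] => *; rewrite !wE.
  - by move=> a b c; rewrite !wE flat_layered.
  - by apply/(graph_leP _ wfg) => a b gab; rewrite !wE; apply: flat_ge; rewrite ?gab ?wgt_le.
have po := @porder_on_stratum n _ (@subset_refl _ (stratum n)).
apply: (contractible_max R po Stop) => h Sh.
suff -> : h = top by have [refl _ _] := po; exact: refl.
by apply: eq_graph => a b; rewrite wE; apply: stratum_flat.
Qed.

(** * Fibres of the collapse map *)

Section Fiber.
Variables (k : nat) (y : graph n A).
Hypothesis k0 : 0 < k.
Hypothesis kn : k < n.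
Hypothesis Sy : stratum k.+1 y.
Implicit Types (s : {set {set A}}) (I : {set A}).

Definition fiber : set (graph n A) := [set h | stratum k h /\ graph_le (collapse k.+1 h) y].

(** On the fibre this is a strict weak order: asymmetric, and negatively transitive by
    [precedes_split]. It follows [y] on the heavy pairs, those of weight above [k.+1] in [y], and
    elsewhere records where [h] has weight [k.+1]. *)
Definition precedes h a b := (k.+1 < wgt y a b) || (wgt y b a <= k.+1) && (wgt h a b == k.+1).

Definition cuts_of h : {set {set A}} := finset (fun I : {set A} =>
  [forall a, forall b, (a \in I) && (b \notin I) ==> precedes h a b]).

Definition sep s a b := [exists I in s, (a \in I) && (b \notin I)].

(** A chain of cuts only decides which light pairs of [y] rise from [k] to [k.+1], and in which
    direction; the others have no freedom in [stratum k]. *)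
Definition filler s a b := if sep s a b then k.+1 else if sep s b a then 0 else flat k a b.

Definition realize s := merge k.+1 y (filler s).

(** The second clause collects pairs on which lying above [g] forces weight [k.+1]. All these pairs
    are edges of [y], which yields the rank function in [contractible_fiber]. *)
Definition must_cut a b := (k.+1 < wgt y a b) || (wgt y a b == k.+1) && (wgt g a b == k.+1).

Lemma fiber_wf h : fiber h -> wf_graph h.
Proof. by move=> [/stratum_wf]. Qed.

(** Weights above [k.+1] are untouched by the collapse, so membership in the fibre compares them
    with [y] directly. *)
Lemma fiber_strong h a b : fiber h -> k.+1 < wgt h a b ->
  wgt h a b <= wgt y a b \/ wgt h a b < wgt y b a.
Proof.
move=> Fh hab; have [[wfh lh gh _]] := Fh.
have [wfc _ _ _] : stratum k.+1 (collapse k.+1 h) by exact: collapse_in.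
move=> /(graph_leP _ wfc)/(_ a b); rewrite wgt_collapse // /strong hab /=.
by apply; exact: leq_ltn_trans hab.
Qed.

Lemma fiber_weak h a b : fiber h -> ~~ strong k.+1 y a b -> ~~ strong k.+1 h a b.
Proof.
rewrite !strongN => Fh /andP[yab yba].
by have := @fiber_strong h a b Fh; have := @fiber_strong h b a Fh; lia.
Qed.

Lemma precedes_asym h a b : fiber h -> precedes h a b -> precedes h b a -> False.
Proof.
move=> /fiber_wf/wf_graphP[_ [has _]]; have /stratum_wf/wf_graphP[_ [yas _]] := Sy.
by rewrite /precedes; have := has a b; have := yas a b; lia.
Qed.

(** The ultrametric inequality for [y] splits a heavy edge, that for [h] an edge of weight [k.+1].
    In the second case, an edge of [y] that is heavy in the wrong direction forces the other pair to
    be heavy in the right one. *)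
Lemma precedes_split h a b c : fiber h -> precedes h a c -> precedes h a b || precedes h b c.
Proof.
move=> Fh; have [[wfh lh _ _] _] := Fh; have [wfy ly _ _] := Sy.
have /wf_graphP[_ [has _]] := wfh.
rewrite {1}/precedes => /orP[yac|/andP[yca /eqP hac]].
  move: (leq_trans yac (ly a b c)); rewrite leq_max => /orP[H|H].
    by rewrite /precedes H.
  by rewrite orbC /precedes H.
have := lh a b c; rewrite hac leq_max => /orP[hab|hbc].
- have [yab|yab] := ltnP k.+1 (wgt y a b); first by rewrite /precedes yab.
  have [yba|yba] := ltnP k.+1 (wgt y b a).
    move: (leq_trans yba (ly b c a)); rewrite leq_max => /orP[H|]; last by lia.
    by rewrite orbC /precedes H.
  have := @fiber_weak h a b Fh; rewrite !strongN yab yba /= => /(_ isT).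
  by rewrite /precedes yba; lia.
- have [ybc|ybc] := ltnP k.+1 (wgt y b c); first by rewrite orbC /precedes ybc.
  have [ycb|ycb] := ltnP k.+1 (wgt y c b).
    move: (leq_trans ycb (ly c a b)); rewrite leq_max => /orP[|H]; first by lia.
    by rewrite /precedes H.
  have := @fiber_weak h b c Fh; rewrite !strongN ybc ycb /= => /(_ isT).
  by rewrite orbC /precedes ycb; lia.
Qed.

(** The separating witness is the set of predecessors of [b], a cut by negative transitivity. *)
Lemma sep_cuts_of h a b : fiber h -> sep (cuts_of h) a b = precedes h a b.
Proof.
move=> Fh; apply/exists_inP/idP => [[I]|ab].
  by rewrite finset.in_set => /forallP/(_ a)/forallP/(_ b)/implyP; exact.
exists (finset (fun x => precedes h x b)).
  rewrite finset.in_set; apply/forallP => x; apply/forallP => z; apply/implyP.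
  rewrite !finset.in_set => /andP[xb zb].
  by have := precedes_split z Fh xb; rewrite (negbTE zb) orbF.
by rewrite !finset.in_set ab; apply/negP => bb; exact: (precedes_asym Fh bb bb).
Qed.

Lemma sepP s a b : reflect (exists I, [/\ I \in s, a \in I & b \notin I]) (sep s a b).
Proof.
by apply: (iffP exists_inP) => [[I Is /andP[]]|[I [Is aI bI]]]; exists I => //; rewrite aI.
Qed.

Lemma sep_split s a b c : sep s a c -> sep s a b || sep s b c.
Proof.
move=> /sepP[I [Is aI cI]]; case bI: (b \in I); apply/orP; [right|left];
  by apply/sepP; exists I; rewrite bI.
Qed.

Lemma sepS s s' a b : s \subset s' -> sep s a b -> sep s' a b.
Proof. by move=> /fintype.subsetP ss' /sepP[I [/ss' Is aI bI]]; apply/sepP; exists I. Qed.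

(** Two cuts that are not nested would give vertices preceding each other. A pair light in [y] is
    light in [h], so an edge of [g] of weight [k.+1] on it must occur in [h] unchanged. *)
Lemma cuts_of_chain h : fiber h -> cut_chain must_cut (cuts_of h).
Proof.
move=> Fh; split=> [I J Is Js|a b Cab].
  have [IJ|/fintype.subsetPn[a aI aJ]] := boolP (I \subset J); first by left.
  right; apply/fintype.subsetP => b bJ; apply: contraT => bI; exfalso.
  have ab : sep (cuts_of h) a b by apply/sepP; exists I.
  have ba : sep (cuts_of h) b a by apply/sepP; exists J.
  by move: ab ba; rewrite !sep_cuts_of //; exact: precedes_asym.
apply/sepP; rewrite sep_cuts_of //.
have [[wfh lh /(graph_leP _ wfg) gh _] _] := Fh.
have /stratum_wf/wf_graphP[_ [yas _]] := Sy.
move: Cab => /orP[yab|/andP[/eqP yab /eqP gab]]; first by rewrite /precedes yab.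
have yba : wgt y b a = 0 by have := yas a b; lia.
have := gh a b; rewrite gab => /(_ isT).
have := @fiber_weak h a b Fh; rewrite !strongN yab yba leqnn /= => /(_ isT).
by rewrite /precedes yab yba; lia.
Qed.

(** Where [y] is light, so is [h']: an edge of weight [k.+1] can neither get heavier nor be
    reversed. *)
Lemma cuts_of_mono h h' : fiber h -> fiber h' -> graph_le h h' -> cuts_of h \subset cuts_of h'.
Proof.
move=> Fh Fh' /(graph_leP _ (fiber_wf Fh)) hh'; apply/fintype.subsetP => I.
rewrite !finset.in_set => /forallP Ih; apply/forallP => a; apply/forallP => b.
move: (Ih a) => /forallP/(_ b); case: (_ && _) => //=.
rewrite /precedes; case: ltnP => //= yab /andP[yba /eqP hab].
rewrite yba /=; have := hh' a b; rewrite hab => /(_ isT).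
have := @fiber_weak h' a b Fh'; rewrite !strongN yab yba /= => /(_ isT).
by lia.
Qed.

Section Realize.
Variable s : {set {set A}}.
Hypothesis Cs : cut_chain must_cut s.

Lemma sep_asym a b : sep s a b -> sep s b a = false.
Proof.
have [chain _] := Cs; move=> /sepP[I [Is aI bI]]; case: (@sepP s b a) => // -[J [Js bJ aJ]].
case: (chain I J Is Js) => /fintype.subsetP sub; first by rewrite sub in aJ.
by rewrite sub in bI.
Qed.

Lemma sep_refl a : sep s a a = false.
Proof. by case saa: (sep s a a) => //; rewrite -saa (sep_asym saa). Qed.

Lemma filler_le a b : filler s a b <= k.+1.
Proof.
rewrite /filler; case: ifP => // _; case: ifP => // _.
exact: leq_trans (flat_le _ _ _) (leqnSn k).
Qed.

Lemma wgt_realize a b :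
  wgt (realize s) a b = if strong k.+1 y a b then wgt y a b else filler s a b.
Proof. by rewrite wgt_merge // => *; exact: leq_trans (filler_le _ _) kn. Qed.

(** Unless the left side is 0, [sep_split] shows that either a separated side carries weight [k.+1]
    or all three pairs are unseparated and [flat_layered] applies. *)
Lemma filler_layered a b c : filler s a c <= maxn (filler s a b) (filler s b c).
Proof.
rewrite /filler; have := @sep_split s a b c; have := @sep_split s c b a.
have [ac _ /(_ isT)/orP[->|->]|_] := boolP (sep s a c).
- by rewrite leq_max leqnn.
- by rewrite leq_max leqnn orbT.
have [//|ca _ _] := boolP (sep s c a).
have [_|ab] := boolP (sep s a b).
  by rewrite leq_max (leq_trans (flat_le _ _ _) (leqnSn k)).
have [_|bc] := boolP (sep s b c).
  by rewrite leq_max (leq_trans (flat_le _ _ _) (leqnSn k)) orbT.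
have [sba|ba] := boolP (sep s b a).
  by have := sep_split c sba; rewrite (negbTE bc) (negbTE ca).
have [scb|cb] := boolP (sep s c b); last exact: flat_layered.
by have := sep_split a scb; rewrite (negbTE ca) (negbTE ab).
Qed.

Lemma realize_wf : wf_graph (realize s).
Proof.
have [f0 fas ftot] := flat_wf k0; apply: merge_wf.
- by move=> *; exact: leq_trans (filler_le _ _) kn.
- exact: stratum_wf Sy.
- by move=> a; rewrite /filler sep_refl.
- move=> a b; rewrite /filler; have [sab|_] := boolP (sep s a b).
    by rewrite (sep_asym sab); right.
  by case: ifP; [left | move=> _; exact: fas].
- move=> a b; rewrite /filler; have [sab|_] := boolP (sep s a b); first by right.
  by case: ifP => _; [right; rewrite addnC | exact: ftot].
Qed.

Lemma stratum_realize : stratum k (realize s).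
Proof.
have [wfy ly /(graph_leP _ wfg) gy yK] := Sy; have /wf_graphP[y0 [yas ytot]] := wfy.
split; first exact: realize_wf.
- apply: merge_layered => //; first exact: filler_le.
    by move=> *; exact: leq_trans (filler_le _ _) kn.
  exact: filler_layered.
- apply/(graph_leP _ wfg) => a b gab; rewrite !wgt_realize (strongC _ _ b a).
  case: ifP => [_|/negbT]; first exact: gy.
  rewrite strongN => /andP[yab yba].
  have gK : wgt g a b <= k.+1 by have := gy a b gab; lia.
  (* An edge of [g] of weight [k.+1] on a light pair of [y] also has weight [k.+1] in [y], so it has
     to be cut. *)
  have gKs : wgt g a b = k.+1 -> sep s a b.
    move=> gabK; have [_ cs] := Cs; apply/sepP; apply: cs.
    by rewrite /must_cut gabK eqxx andbT; have := gy a b gab; lia.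
  rewrite /filler; have [sab|nab] := boolP (sep s a b); first by left.
  have gk : wgt g a b <= k.
    by rewrite -ltnS ltn_neqAle gK andbT; apply: contraNneq nab.
  case: ifP => _; first by right.
  by apply: flat_ge => //; rewrite gab.
- move=> a b; rewrite wgt_realize; case: ifP => [/orP[yab|yba]|_].
  + by move=> _; lia.
  + by have := yas a b; lia.
  + rewrite /filler /flat; case: ifP => [_ _|_]; first by lia.
    by case: ifP => // _; case: ifP.
Qed.

(** The heavy pairs of [realize s] are those of [y]; on the rest [y] is flat by [stratum_flat]. So
    the collapse agrees with [y] on every pair. *)
Lemma collapse_realize : graph_le (collapse k.+1 (realize s)) y.
Proof.
have [wfr lr gr _] := stratum_realize.
have [wfc _ _ _] : stratum k.+1 (collapse k.+1 (realize s)) by exact: collapse_in.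
apply/(graph_leP _ wfc) => a b.
have rE : strong k.+1 (realize s) a b = strong k.+1 y a b.
  rewrite {1}/strong !wgt_realize (strongC _ _ b a); case: ifP => // _.
  by apply/negbTE; rewrite negb_or -!leqNgt !filler_le.
rewrite wgt_collapse // rE; case: ifP => [ys|/negbT ys].
  by rewrite wgt_realize ys => _; left.
by rewrite (stratum_flat _ Sy ys) // => _; left.
Qed.

End Realize.

(** More cuts only raise weights from [k] to [k.+1], and an edge whose weight strictly increases may
    be reversed. *)
Lemma realize_mono s s' : cut_chain must_cut s -> cut_chain must_cut s' ->
  s \subset s' -> graph_le (realize s) (realize s').
Proof.
move=> Cs Cs' ss'; apply/(graph_leP _ (realize_wf Cs)) => a b.
rewrite !wgt_realize // (strongC _ _ b a); case: ifP => [_ _|_]; first by left.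
have := @sepS s s' a b ss'; have := @sepS s s' b a ss'; have := flat_le k a b.
rewrite /filler; case: (sep s a b) => [_ _ /(_ isT) -> _|]; first by left.
case: (sep s b a) => // fk _ _.
by case: (sep s' a b); [left; lia | case: (sep s' b a); [right; lia | left]].
Qed.

(** On pairs heavy in [y], [fiber_strong] covers the heavy edges of [h]. On light pairs the cuts
    retain every edge of weight [k.+1], and an edge of weight [k] follows [tau k]. *)
Lemma realize_cuts_of h : fiber h -> graph_le h (realize (cuts_of h)).
Proof.
move=> Fh; have [[wfh lh gh hk] hy] := Fh.
have Cs := cuts_of_chain Fh.
apply/(graph_leP _ wfh) => a b hab; rewrite !wgt_realize // (strongC _ _ b a).
case: ifP => [/orP ys|/negbT ys].
  have [hK|hK] := ltnP k.+1 (wgt h a b); first exact: fiber_strong.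
  by lia.
have := fiber_weak Fh ys; move: ys; rewrite !strongN => /andP[yab yba] /andP[hab' hba'].
have [hk1 hk2] := hk a b hab.
rewrite /filler !sep_cuts_of //.
have [_|nab] := boolP (precedes h a b); first by left.
have {hk1 nab} habk : wgt h a b = k.
  by move: nab; rewrite /precedes; lia.
case: ifP => _; first by right; lia.
by left; rewrite /flat hk2 // habk.
Qed.

Lemma contractible_fiber (R : realType) :
  contractible (classifying_space R _ (@graph_le n A) fiber).
Proof.
have [wfy ly _ _] := Sy; have cy : cells y by [].
(* Counting predecessors in [y] gives a strict rank, because the edges of [y] are transitive and
   loop-free. *)
pose rk a := #|[pred x | edge y x a]|.
have rkC a b : must_cut a b -> rk a < rk b.
  move=> Cab; have yab : edge y a b by move: Cab; rewrite /must_cut /edge; lia.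
  apply: proper_card; apply/properP; split.
    by apply/fintype.subsetP => x; rewrite !inE => xa; exact: (edge_trans cy) xa yab.
  exists a; rewrite !inE //.
  by have /wf_graphP[y0 _] := wfy; rewrite /edge y0.
have rkN a : rk a < #|A|.+1 by rewrite ltnS max_card.
apply: (poset_contractible_dominated (t := cuts_of) (s := realize))
  (contractible_cut_chain R rkC rkN).
- by apply: (@porder_on_stratum k) => h [].
- by split=> [h Fh|h h' Fh Fh' hh']; [exact: cuts_of_chain | exact: cuts_of_mono].
- split=> [s Cs|s s' Cs Cs' ss']; last exact: realize_mono.
  by split; [exact: stratum_realize | exact: collapse_realize].
- exact: realize_cuts_of.
Qed.

End Fiber.

(** Downward induction from the one-point stratum [n], with one fibre argument per weight; [n - k]
    is the induction variable. *)
Lemma contractible_stratum (R : realType) k : 0 < k <= n ->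
  contractible (classifying_space R _ (@graph_le n A) (stratum k)).
Proof.
move=> /andP[k0 kn]; rewrite -(subKn kn).
have : n - k < n by lia.
elim: (n - k) => [|d IH] dn; first by rewrite subn0; exact: contractible_stratum_top.
have e : n - d = (n - d.+1).+1 by lia.
have kn' : n - d.+1 < n by lia.
have k0' : 0 < n - d.+1 by lia.
have := IH (ltnW dn); rewrite e => IHd.
apply: (quillen_fiber (q := collapse (n - d.+1).+1)) IHd.
- exact: (@porder_on_stratum (n - d.+1)).
- exact: (@porder_on_stratum (n - d.+1).+1).
- split=> [h [wfh lh gh _]|h h' [wfh lh gh _] _ hh']; first exact: collapse_in.
  apply: collapse_mono => //.
  by have [] : stratum (n - d.+1).+1 (collapse (n - d.+1).+1 h) by exact: collapse_in.
- by move=> y Sy; exact: contractible_fiber.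
Qed.

End Above.
End Graphs.

(** * Contractibility above a graph and the conclusion *)

Lemma contractible_cells_above (R : realType) n (A : finType) (g : graph n A) :
  0 < n -> Gn_ext g ->
  contractible (classifying_space R _ (@graph_le n A) [set h | cells h /\ graph_le g h]).
Proof.
move=> n0 [wfg nocyc].
(* The edges of each single weight are acyclic by definition of [Gn_ext], so they extend to linear
   orders. *)
have [|tau tauP] := @choice nat (A -> nat) (fun k rk =>
    injective rk /\ forall a b, edge_w g k a b -> rk a < rk b).
  by move=> k; have [rk ? ?] := acyclic_linear_extension (nocyc k); exists rk.
have tau_inj k : injective (tau k) by have [] := tauP k.
have tau_edge k a b : 0 < k -> wgt g a b = k -> tau k a < tau k b.
  by move=> k0 gab; have [_] := tauP k; apply; rewrite /edge_w k0 gab eqxx.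
(* The first stratum imposes no further condition: an edge of weight 1 in [h] can only lie over the
   same edge of weight 1 in [g], which follows [tau 1]. *)
suff -> : [set h | cells h /\ graph_le g h] = stratum g tau 1.
  by apply: contractible_stratum; rewrite ?n0.
apply/seteqP; split=> h; last by case.
case=> -[wfh lh] gh; split=> // a b hab; split=> // hab1.
apply: tau_edge => //; have /wf_graphP[g0 [gas gtot]] := wfg.
have /wf_graphP[h0 [has htot]] := wfh.
move/(graph_leP _ wfg): gh => gh.
have [ab|] := gtot a b; first by move: hab; rewrite ab h0.
by have := gh a b; have := gh b a; have := has a b; have := gas a b; lia.
Qed.

Theorem theorem4 (R : realType) (n : nat) (A : finType) (hn : (1 <= n)%N) :
  weak_homotopy_equivalence R
    (classifying_space R (graph n A) (@graph_le n A) (@Gn n A))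
    (classifying_space R (graph n A) (@graph_le n A) (@Gn_ext n A))
    id.
Proof.
have po : porder_on (@graph_le n A) (@Gn_ext n A) by apply: porder_on_graphs => g [].
apply: sdr_weak_homotopy_equivalence; first exact: classifying_spaceS (@Gn_sub_Gn_ext n A).
apply: (quillen_inclusion po (@cells_sub_Gn n A) (@Gn_sub_Gn_ext n A)) => g Qg Mg.
(* Since [g] is not in [cells], the strict upper link is everything in [cells] above [g]. *)
suff -> : [set h | cells h /\ (h != g) && graph_le g h] = [set h | cells h /\ graph_le g h].
  exact: contractible_cells_above.
apply/seteqP; split=> h [Mh]; first by move=> /andP[_ ?]; split.
by move=> gh; split => //; rewrite gh andbT; apply: contra_notN Mg => /eqP <-.
Qed.
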